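(* Let $\omega=(\omega_x)_{x\in\mathbb{Z}}$ be a random environment, i.e. a sequence of i.i.d. random variables with values in $(0,1)$ under a probability measure $\mathsf{P}$, such that, with $\rho_0:=\frac{1-\omega_0}{\omega_0}$: (i) $\mathsf{E}[\log\rho_0]=0$; (ii) $\mathsf{P}(\varepsilon\le\omega_0\le 1-\varepsilon)=1$ for some $\varepsilon\in(0,\tfrac12)$; (iii) $\mathsf{Var}(\log\rho_0)>0$. For fixed $\omega$, let $(X_n,Y_n)_{n\in\mathbb{N}_0}$ be a two-dimensional process such that, with respect to $P_\omega$, the processes $(X_n)_{n\in\mathbb{N}_0}$ and $(Y_n)_{n\in\mathbb{N}_0}$ are independent, $(X_n)_{n\in\mathbb{N}_0}$ is a random walk in the environment $\omega$ started at $0$, and $(Y_n)_{n\in\mathbb{N}_0}$ is a symmetric random walk on $\mathbb{Z}$ started at $0$. Then $(X_n,Y_n)_{n\in\mathbb{N}_0}$ is recurrent for $\mathsf{P}$-a.e. environment $\omega$.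
   Context: $\mathbb{N}_0=\{0,1,2,\dots\}$. For a fixed environment $\omega\in(0,1)^{\mathbb{Z}}$, a random walk in the environment $\omega$ started at $0$ is the Markov chain $(X_n)_{n\in\mathbb{N}_0}$ on $\mathbb{Z}$ with $X_0=0$ and $P_\omega(X_{n+1}=y+1\mid X_n=y)=\omega_y=1-P_\omega(X_{n+1}=y-1\mid X_n=y)$ for all $y\in\mathbb{Z}$. The symmetric random walk on $\mathbb{Z}$ has i.i.d. increments equal to $\pm1$ with probability $\tfrac12$ each. For fixed $\omega$, $(X_n,Y_n)$ is a Markov chain on $\mathbb{Z}^2$ started at $(0,0)$; recurrent means that, $P_\omega$-almost surely, it returns to $(0,0)$ infinitely often. *)

(* Defs.v *)
From HB Require Import structures.
From mathcomp Require Export all_boot all_order all_algebra.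
From mathcomp Require Export all_classical all_reals all_analysis.

Set Implicit Arguments.
Unset Strict Implicit.
Unset Printing Implicit Defensive.

Import Order.TTheory GRing.Theory Num.Theory.

Local Open Scope classical_set_scope.
Local Open Scope ring_scope.

HB.instance Definition _ := isPointed.Build int 0.

HB.instance Definition _ := @isMeasurable.Build default_measure_display
  int discrete_measurable discrete_measurable0
  discrete_measurableC discrete_measurableU.

Section independence.
Context (d d' : measure_display) (T : measurableType d) (S : measurableType d').
Context (R : realType) (P : probability T R).

Definition mutually_independent (I : eqType) (Z : I -> T -> S) :=
  forall (s : seq I) (B : I -> set S), uniq s ->
    (forall i, i \in s -> measurable (B i)) ->
    P (\bigcap_(i in [set` s]) (Z i @^-1` B i)) =
    (\prod_(i <- s) P (Z i @^-1` B i))%E.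

Definition identically_distributed (I : Type) (Z : I -> T -> S) :=
  forall (i j : I) (B : set S), measurable B ->
    P (Z i @^-1` B) = P (Z j @^-1` B).

Definition iid (I : eqType) (Z : I -> T -> S) :=
  mutually_independent Z /\ identically_distributed Z.

Definition process_sigma_algebra (I : Type) (Z : I -> T -> S) : set (set T) :=
  <<s [set A | exists i (B : set S), measurable B /\ A = Z i @^-1` B] >>.

Definition independent_processes (I : Type) (X Y : I -> T -> S) :=
  forall A B : set T, process_sigma_algebra X A -> process_sigma_algebra Y B ->
    P (A `&` B) = (P A * P B)%E.

End independence.

Section random_walks.
Context (d : measure_display) (T : measurableType d).
Context (R : realType) (Q : probability T R).

(* Q(A | B); only used under the hypothesis Q B != 0. *)
Definition cond_prob (A B : set T) : R := fine (Q (A `&` B)) / fine (Q B).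

Definition markov_property (X : nat -> T -> int) :=
  forall (n : nat) (x : nat -> int) (z : int),
    let past := [set t | forall i, (i <= n)%N -> X i t = x i] in
    Q past != 0%E ->
    cond_prob [set t | X n.+1 t = z] past =
    cond_prob [set t | X n.+1 t = z] [set t | X n t = x n].

Definition random_walk_in_environment (w : int -> R) (X : nat -> T -> int) :=
  [/\ Q [set t | X 0%N t = 0] = 1%E,
      markov_property X &
      forall (n : nat) (y : int), Q [set t | X n t = y] != 0%E ->
        cond_prob [set t | X n.+1 t = y + 1] [set t | X n t = y] = w y /\
        cond_prob [set t | X n.+1 t = y - 1] [set t | X n t = y] = 1 - w y].

Definition increment (Y : nat -> T -> int) (n : nat) (t : T) : int :=
  Y n.+1 t - Y n t.

Definition symmetric_random_walk (Y : nat -> T -> int) :=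
  [/\ Q [set t | Y 0%N t = 0] = 1%E,
      iid Q (increment Y) &
      forall n : nat,
        Q [set t | increment Y n t = 1] = (2^-1)%:E /\
        Q [set t | increment Y n t = -1] = (2^-1)%:E].

Definition recurrent (Z : nat -> T -> int * int) :=
  {ae Q, forall t, infinite_set [set n | Z n t = (0, 0)]}.

End random_walks.

Definition rho (R : realType) (w : int -> R) (x : int) : R :=
  (1 - w x) / w x.

(* Main.v *)
(** The environment has a potential [V], a random walk with i.i.d. centred
    bounded steps on either side of the origin.  By gambler's ruin on independent
    blocks, almost surely there are infinitely many scales [l] at which [V]
    climbs to height [15 l] on both sides of the origin, within distance
    [O(l^2)], before going below [- 2 l].  At such a scale the walk [X] is
    trapped in a box up to time [N] of order [exp (15 l)]; reversibility and the
    Cauchy-Schwarz inequality then give a probability of order at least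
    [exp (- 2 l) / l^2] of being at [0] at any even time up to [N].  As the
    simple walk [Y] returns with probability of order [n^(-1/2)], the expected
    number of returns of [(X, Y)] to the origin up to time [N] is of order at
    least [sqrt N * exp (- 2 l) / l^2], which is unbounded in [l].  A
    decomposition at the last visit turns this divergence into recurrence. *)
From mathcomp Require Import ring lra zify.
From mathcomp Require Import measurable_realfun.
Require Import Defs.
Import Order.TTheory GRing.Theory Num.Theory.

Set Implicit Arguments.
Unset Strict Implicit.
Unset Printing Implicit Defensive.

Local Open Scope classical_set_scope.
Local Open Scope ring_scope.

(** * Return probabilities of nearest-neighbour walks *)

(** The exceptional set of environments has to be fixed before any probability space carrying the
    walks is given. Hence the analysis is done on [return_prob], a function of the environment
    alone; the walks enter only at the end, where their visit probabilities are bounded below by it.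
    Blocks make the good scales independent: a block of scale [l] reads only sites not read before,
    and its scale is so large that everything accumulated over earlier blocks changes the potential
    by at most [l]. A climb of [16 l] made inside the block therefore ends at height at least
    [15 l], and a descent of less than [l] stays above [- 2 l]. With block length [K l^2] and [K]
    large against the inverse variance of the steps, the first two moments of a stopped walk bound
    the probability of each climb below by [1/36], uniformly in [l]. *)

Section nearest_neighbour_walk.
Context {R : realType}.
Implicit Types (w u v : int -> R) (a b : nat).

(** Probability that the walk from [y] is at [0] after [m] steps, by decomposition at the first step
    (the backward equation). *)
Fixpoint return_prob w (m : nat) (y : int) : R :=
  if m is m'.+1 then
    w y * return_prob w m' (y + 1) + (1 - w y) * return_prob w m' (y - 1)
  else (y == 0)%:R.

(** Half-open, so that the box has [a + b] sites; the walk leaves it at [- a.+1] or at [b]. *)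
Definition in_box a b (y : int) : bool := - a%:Z <= y < b%:Z.

Definition killed_step w a b u (y : int) : R :=
  if in_box a b y then w y * u (y + 1) + (1 - w y) * u (y - 1) else 0.

Definition supported a b u := forall y, ~~ in_box a b y -> u y = 0.

Lemma killed_step_supported w a b u : supported a b (killed_step w a b u).
Proof. by move=> y /negbTE ny; rewrite /killed_step ny. Qed.

Lemma iter_killed_supported w a b u n :
  supported a b u -> supported a b (iter n (killed_step w a b) u).
Proof. by case: n => // n _; exact: killed_step_supported. Qed.

Definition box_site a (i : nat) : int := i%:Z - a%:Z.

Lemma in_box_site a b i : (i < a + b)%N -> in_box a b (box_site a i).
Proof. by rewrite /in_box /box_site => ?; apply/andP; split; lia. Qed.

Lemma return_prob_ge0 w n y : (forall x, 0 < w x < 1) -> 0 <= return_prob w n y.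
Proof.
move=> w01; elim: n y => [|n IH] y /=; first by rewrite ler0n.
by have /andP[? ?] := w01 y; rewrite addr_ge0// mulr_ge0// ?subr_ge0 ltW.
Qed.

Lemma killed_le_return w a b n y : (forall x, 0 < w x < 1) ->
  iter n (killed_step w a b) (fun x => (x == 0)%:R) y <= return_prob w n y.
Proof.
move=> w01; have pos m x := return_prob_ge0 m x w01.
elim: n y => [|n IH] y //=; rewrite /killed_step.
have /andP[? ?] := w01 y.
case: ifP => _; first by rewrite lerD// ler_wpM2l// ?subr_ge0 ltW.
by rewrite addr_ge0// mulr_ge0// ?subr_ge0 ltW.
Qed.

(** * Reversibility and survival in a box *)

Section reversible.
Variables (w E : int -> R).
Hypothesis w01 : forall y, 0 < w y < 1.
Hypothesis Epos : forall y, 0 < E y.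
Hypothesis Erec : forall y, E y * w y = E (y - 1) * (1 - w y).
Hypothesis E0 : E 0 = 1.

(* [E] is the exponential of the potential, so [(E y)^-1] is the conductance of
   the edge between [y] and [y + 1]. *)
Definition rev_measure (y : int) : R := (E y)^-1 + (E (y - 1))^-1.

Lemma rev_measure_gt0 y : 0 < rev_measure y.
Proof. by rewrite addr_gt0// invr_gt0. Qed.

(** With [rev_measure_left] this is detailed balance: the edge between [y] and [y + 1] carries the
    flow [(E y)^-1] in both directions. *)
Lemma rev_measure_right y : rev_measure y * w y = (E y)^-1.
Proof.
have := Erec y; rewrite /rev_measure; have := Epos y; have := Epos (y - 1).
move: (E y) (E (y - 1)) (w y) => e e' p e'0 e0 H.
have -> : p = e' * (e + e')^-1.
  by apply/(canRL (mulfK _)); [rewrite gt_eqF// addr_gt0 | lra].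
by field; rewrite !gt_eqF// addr_gt0.
Qed.

Lemma rev_measure_left y : rev_measure y * (1 - w y) = (E (y - 1))^-1.
Proof. by rewrite mulrBr mulr1 rev_measure_right /rev_measure addrAC subrr add0r. Qed.

Definition box_dot a b u v : R :=
  \sum_(0 <= i < a + b) rev_measure (box_site a i) * u (box_site a i) * v (box_site a i).

Lemma box_dotC a b u v : box_dot a b u v = box_dot a b v u.
Proof. by apply: eq_bigr => i _; rewrite -mulrA (mulrC (u _)) mulrA. Qed.

(** The right-hand side is symmetric in [u] and [v], whence self-adjointness. Detailed balance turns
    the left-hand side into a sum over edges; the edges to the left are re-indexed by a telescoping
    sum whose end terms contain [v b] and [u (- a - 1)], both outside the box. *)
Lemma box_dot_killed_step a b u v : supported a b u -> supported a b v ->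
  box_dot a b (killed_step w a b u) v =
  \sum_(0 <= i < a + b) ((E (box_site a i))^-1 * u (box_site a i + 1) * v (box_site a i)
     + (E (box_site a i))^-1 * u (box_site a i) * v (box_site a i + 1)).
Proof.
move=> su sv.
pose H (x : int) := (E x)^-1 * u x * v (x + 1).
have siteS i : box_site a i.+1 - 1 = box_site a i by rewrite /box_site; lia.
have tele : \sum_(0 <= i < a + b) (H (box_site a i) - H (box_site a i - 1)) = 0.
  under eq_bigr do rewrite -{1}siteS.
  rewrite (telescope_sumr (fun i => H (box_site a i - 1))) ?leq0n// /H.
  rewrite [v _]sv; last by rewrite /in_box /box_site; lia.
  rewrite [u (box_site a 0 - 1)]su; last by rewrite /in_box /box_site; lia.
  by rewrite !mulr0 mul0r subrr.
rewrite -[RHS]subr0 -[X in _ = _ - X]tele -sumrB; apply: eq_big_nat => i /andP[_ hi].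
rewrite /killed_step in_box_site// /H.
rewrite mulrDr !mulrA rev_measure_right rev_measure_left subrK; ring.
Qed.

Lemma box_dot_killed_step_adj a b u v : supported a b u -> supported a b v ->
  box_dot a b (killed_step w a b u) v = box_dot a b u (killed_step w a b v).
Proof.
move=> su sv; rewrite [RHS]box_dotC !box_dot_killed_step//.
by apply: eq_bigr => i _; ring.
Qed.

Lemma box_dot_iter_adj a b n u v : supported a b u -> supported a b v ->
  box_dot a b (iter n (killed_step w a b) u) v =
  box_dot a b u (iter n (killed_step w a b) v).
Proof.
elim: n v => // n IH v su sv; rewrite iterS box_dot_killed_step_adj//.
  by rewrite IH ?iterSr//; exact: killed_step_supported.
exact: iter_killed_supported.
Qed.

Lemma supported_delta0 a b : (0 < b)%N ->
  supported a b (fun y => (y == 0)%:R).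
Proof.
by move=> b0 y; case: eqP => //= ->; rewrite /in_box; lia.
Qed.

Lemma box_dot_delta0 a b u : (0 < b)%N ->
  box_dot a b (fun y => (y == 0)%:R) u = rev_measure 0 * u 0.
Proof.
move=> b0; rewrite /box_dot (bigD1_seq a) ?iota_uniq//=; last by rewrite mem_index_iota; lia.
rewrite [X in _ + X]big1 ?addr0 => [|i ia].
  by rewrite /box_site subrr eqxx mulr1.
have /negbTE -> : box_site a i != 0 by rewrite /box_site; lia.
by rewrite mulr0 mul0r.
Qed.

(** Expanding the nonnegative sum of [p i * (f i * S0 - S1) ^+ 2] gives [S0 * (S2 * S0 - S1 ^+ 2)],
    and [S0] can be cancelled unless it vanishes. *)
Lemma sum_cauchy_schwarz (s : seq nat) (p f : nat -> R) : (forall i, 0 < p i) ->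
  (\sum_(i <- s) p i * f i) ^+ 2 <=
  (\sum_(i <- s) p i * f i * f i) * \sum_(i <- s) p i.
Proof.
move=> p0; set S1 := \sum_(i <- s) p i * f i; set S0 := \sum_(i <- s) p i.
have S0ge : 0 <= S0 by apply: sumr_ge0 => i _; exact: ltW.
have : 0 <= \sum_(i <- s) p i * (f i * S0 - S1) ^+ 2.
  by apply: sumr_ge0 => i _; rewrite mulr_ge0 ?sqr_ge0// ltW.
under eq_bigr => i _.
  rewrite (_ : _ * _ = p i * f i * f i * S0 ^+ 2 - p i * f i * (2 * S0 * S1) + p i * S1 ^+ 2); last by ring.
  over.
rewrite !big_split/= sumrN -!mulr_suml -/S1 -/S0.
set S2 := \sum_(i <- s) _ => h.
have h' : 0 <= S0 * (S2 * S0 - S1 ^+ 2) by lra.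
have [S00|/eqP S00] := eqVneq S0 0; last first.
  rewrite pmulr_rge0 ?subr_ge0// in h'.
  by rewrite lt_neqAle S0ge andbT eq_sym; apply/eqP.
(* As all weights are positive, [S0 = 0] leaves no index in [s]. *)
have S10 : S1 = 0.
  rewrite /S1; apply: big1_seq => i /andP[_ si].
  have : p i <= S0.
    rewrite /S0 (big_rem i)//= lerDl; apply: sumr_ge0 => j _; exact: ltW.
  by rewrite S00 leNgt p0.
by rewrite S10 S00 mulr0 expr0n.
Qed.

Let one_box a b (y : int) : R := (in_box a b y)%:R.

(* With [h] the [n]-th iterate of the killed operator on the indicator of [0],
   self-adjointness gives [<h, h> = pi(0) * p_2n(0, 0)] and
   [<h, 1> = pi(0) * P_0(exit time > n)]; compare by Cauchy-Schwarz. *)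
Lemma return_prob_ge_survival a b n : (0 < b)%N ->
  rev_measure 0 * (iter n (killed_step w a b) (one_box a b) 0) ^+ 2 <=
  return_prob w n.*2 0 * \sum_(0 <= i < a + b) rev_measure (box_site a i).
Proof.
move=> b0; pose delta (y : int) : R := (y == 0)%:R.
have sd : supported a b delta by exact: supported_delta0.
have s1 : supported a b (one_box a b) by move=> y /negbTE; rewrite /one_box => ->.
set h := iter n (killed_step w a b) delta.
have h1 : rev_measure 0 * iter n (killed_step w a b) (one_box a b) 0 =
          \sum_(0 <= i < a + b) rev_measure (box_site a i) * h (box_site a i).
  rewrite -(box_dot_delta0 a _ b0) -box_dot_iter_adj//.
  apply: eq_big_nat => i /andP[_ hi].
  by rewrite /one_box in_box_site// mulr1.
have h2 : rev_measure 0 * iter n.*2 (killed_step w a b) delta 0 =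
   \sum_(0 <= i < a + b) rev_measure (box_site a i) * h (box_site a i) * h (box_site a i).
  rewrite -(box_dot_delta0 a _ b0) -addnn iterD -box_dot_iter_adj//.
  exact: iter_killed_supported.
have := @sum_cauchy_schwarz (index_iota 0 (a + b))
  (fun i => rev_measure (box_site a i)) (fun i => h (box_site a i))
  (fun i => rev_measure_gt0 _).
rewrite -h1 -h2 exprMn expr2 -!mulrA ler_pM2l ?rev_measure_gt0// => /le_trans; apply.
rewrite ler_wpM2r//; last exact: killed_le_return.
by apply: sumr_ge0 => i _; exact/ltW/rev_measure_gt0.
Qed.

Definition scale_fun (y : int) : R :=
  match y with
  | Posz n => \sum_(0 <= i < n) E i%:Z
  | Negz n => - \sum_(0 <= i < n.+1) E (- i.+1%:Z)
  end.

Lemma scale_funS y : scale_fun (y + 1) = scale_fun y + E y.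
Proof.
case: y => [n|[|n]].
- rewrite (_ : n%:Z + 1 = n.+1%:Z); last lia.
  by rewrite /scale_fun big_nat_recr.
- by rewrite (_ : Negz 0 + 1 = 0) //= big_nil big_nat1 NegzE addNr.
- rewrite (_ : Negz n.+1 + 1 = Negz n); last lia.
  by rewrite /scale_fun [in RHS]big_nat_recr//= opprD NegzE subrK.
Qed.

Lemma scale_fun_ge0 (n : nat) : 0 <= scale_fun n%:Z.
Proof. by rewrite sumr_ge0// => i _; exact: ltW. Qed.

Lemma scale_fun_le0 (n : nat) : scale_fun (- n%:Z) <= 0.
Proof.
case: n => [|n]; first by rewrite /= big_nil.
by rewrite -NegzE /= oppr_le0 sumr_ge0// => i _; exact: ltW.
Qed.

(** The increments to the two sides, [E y] and [- E (y - 1)], balance under [w y] and [1 - w y] by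
    [Erec]. *)
Lemma scale_fun_harmonic y :
  w y * scale_fun (y + 1) + (1 - w y) * scale_fun (y - 1) = scale_fun y.
Proof.
have := scale_funS (y - 1); rewrite subrK scale_funS => h.
by have := Erec y; rewrite h; lra.
Qed.

Lemma norm_scale_fun_step y :
  w y * `|scale_fun (y + 1)| + (1 - w y) * `|scale_fun (y - 1)| <=
  `|scale_fun y| + 2.
Proof.
have /andP[w0 w1] := w01 y.
have harm := scale_fun_harmonic y.
case: y w0 w1 harm => [[|n]|n] w0 w1 harm.
- have e1 : scale_fun (0 + 1) = 1 by rewrite scale_funS /= big_nil E0 add0r.
  have e2 : scale_fun (0 - 1) = - E (-1) by rewrite /= big_nat1.
  rewrite e1 e2 normrN normr1 (ger0_norm (ltW (Epos _))).
  (* At [0] the mean absolute value becomes [w 0 * E 0 + (1 - w 0) * E (-1) = 2 * w 0], which is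
     where the [2] comes from. *)
  have := Erec 0; rewrite E0 sub0r.
  have := normr_ge0 (scale_fun 0); lra.
- rewrite (_ : n.+1%:Z + 1 = n.+2%:Z) in harm *; last lia.
  rewrite (_ : n.+1%:Z - 1 = n%:Z) in harm *; last lia.
  by rewrite !ger0_norm ?scale_fun_ge0// harm lerDl.
- rewrite NegzE (_ : - n.+1%:Z + 1 = - n%:Z) in harm w0 w1 *; last lia.
  rewrite (_ : - n.+1%:Z - 1 = - n.+2%:Z) in harm *; last lia.
  rewrite !ler0_norm ?scale_fun_le0//; lra.
Qed.

(* [scale_fun] is harmonic, so its absolute value is harmonic off [0] and gains
   at most [2] per visit to [0]. *)
Lemma survival_ge a b (e : R) n y : 0 <= e ->
  1 <= e * `|scale_fun b%:Z| -> 1 <= e * `|scale_fun (- a.+1%:Z)| ->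
  - a.+1%:Z <= y <= b%:Z ->
  1 - e * `|scale_fun y| - 2 * n%:R * e <= iter n (killed_step w a b) (one_box a b) y.
Proof.
move=> e0 hb ha; elim: n y => [|n IH] y yab.
  rewrite mulr0 mul0r subr0 /=.
  rewrite /one_box; have [_|nbox] /= := boolP (in_box a b y).
    by have := mulr_ge0 e0 (normr_ge0 (scale_fun y)); lra.
  (* Only the two exit sites remain, and there [1 <= e * |scale_fun y|] makes the lower bound
     nonpositive. *)
  have [->|->] : y = b%:Z \/ y = - a.+1%:Z by move: nbox yab; rewrite /in_box; lia.
    lra.
  lra.
rewrite iterS {1}/killed_step; case: ifPn => [box|nbox]; last first.
  have ne : 0 <= 2 * n.+1%:R * e by rewrite !mulr_ge0.
  have [->|->] : y = b%:Z \/ y = - a.+1%:Z by move: nbox yab; rewrite /in_box; lia.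
    lra.
  lra.
have /andP[w0 w1] := w01 y.
have h1 : - a.+1%:Z <= y + 1 <= b%:Z by move: box; rewrite /in_box; lia.
have h2 : - a.+1%:Z <= y - 1 <= b%:Z by move: box; rewrite /in_box; lia.
have w0' := ltW w0; have w1' : 0 <= 1 - w y by rewrite subr_ge0 ltW.
have := lerD (ler_wpM2l w0' (IH _ h1)) (ler_wpM2l w1' (IH _ h2)).
have := ler_wpM2l e0 (norm_scale_fun_step y).
rewrite -natr1; set A := `|_ (y + 1)|; set B := `|_ (y - 1)|.
set C := `|_ y|; set p := w y; set N := n%:R.
move=> H1 H2; apply: le_trans H2; lra.
Qed.

Lemma ler_norm_scale_right b : (0 < b)%N -> E (b%:Z - 1) <= `|scale_fun b%:Z|.
Proof.
case: b => // b _; rewrite ger0_norm ?scale_fun_ge0//.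
rewrite (_ : b.+1%:Z - 1 = b%:Z); last lia.
by rewrite /scale_fun big_nat_recr//= lerDr sumr_ge0// => i _; exact: ltW.
Qed.

Lemma ler_norm_scale_left a : E (- a.+1%:Z) <= `|scale_fun (- a.+1%:Z)|.
Proof.
rewrite ler0_norm ?scale_fun_le0// -NegzE /= opprK big_nat_recr//= -NegzE lerDr.
by rewrite sumr_ge0// => i _; exact: ltW.
Qed.

(** Up to time [D / 4] the walk survives in the box with probability at least [1/2]. The reversible
    measure has mass at most [2 * (a + b) * m] there and at least [1] at the origin, so
    Cauchy-Schwarz yields [1/4 <= 2 * (a + b) * m * return_prob w n.*2 0]. *)
Lemma return_prob_ge_valley a b n (D m : R) : (0 < b)%N ->
  D <= E (b%:Z - 1) -> D <= E (- a.+1%:Z) -> 0 < m ->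
  (forall y, - a.+1%:Z <= y < b%:Z -> (E y)^-1 <= m) ->
  4 * n%:R <= D ->
  1 <= 8 * (a + b)%:R * m * return_prob w n.*2 0.
Proof.
move=> b0 Db Da m0 Em nD.
(* For [n = 0] the barrier [D] may vanish and cannot be inverted, but then the return probability is
   [1] and [1 <= m] because [E 0 = 1]. *)
have [->|n0] := posnP n.
  rewrite /= mulr1; have := Em 0; rewrite E0 invr1 => /(_ _)/=.
  have /[swap]/[apply] : - a.+1%:Z <= 0 < b%:Z by lia.
  move=> m1; have : 1 <= (a + b)%:R :> R by rewrite ler1n; lia.
  by nra.
have n0R : 0 < n%:R :> R by rewrite ltr0n.
have D0 : 0 < D by lra.
have surv : 2^-1 <= iter n (killed_step w a b) (one_box a b) 0.
  apply: le_trans (@survival_ge a b D^-1 n 0 _ _ _ _); rewrite ?invr_ge0 ?(ltW D0)//.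
  - rewrite /= big_nil normr0 mulr0 subr0.
    have : n%:R * D^-1 <= 4^-1 by rewrite ler_pdivrMr//; lra.
    lra.
  - by rewrite ler_pdivlMl// mulr1 (le_trans Db)// ler_norm_scale_right.
  - by rewrite ler_pdivlMl// mulr1 (le_trans Da)// ler_norm_scale_left.
have piM : \sum_(0 <= i < a + b) rev_measure (box_site a i) <= (a + b)%:R * (2 * m).
  rewrite [leRHS](_ : _ = \sum_(0 <= i < a + b) (2 * m)); last first.
    by rewrite big_const_nat iter_addr_0 subn0 mulr_natl.
  rewrite big_nat_cond [leRHS]big_nat_cond; apply: ler_sum => i; rewrite andbT => /andP[_ hi].
  rewrite /rev_measure mulr_natl mulr2n lerD//; apply: Em; rewrite /box_site; lia.
have := return_prob_ge_survival a n b0.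
set q := return_prob _ _ _; have q0 : 0 <= q.
  exact: return_prob_ge0.
have pi1 : 1 <= rev_measure 0 by rewrite /rev_measure E0 invr1 lerDl invr_ge0 ltW.
set s := iter _ _ _ _ in surv * => h.
have s4 : 4^-1 <= s ^+ 2.
  by have := @lerXn2r R 2%N (2^-1) s; rewrite !nnegrE => /(_ _ _ surv); rewrite expr2; lra.
have := ler_wpM2l q0 piM.
have : s ^+ 2 <= rev_measure 0 * s ^+ 2 by rewrite ler_peMl// sqr_ge0.
lra.
Qed.

End reversible.

(** From [2 j - n] the origin is reached at time [n] exactly when [j] of the steps go down; the
    recursion is Pascal's rule, and [far] covers its two boundary cases. *)
Lemma return_prob_half (n j : nat) : (j <= n)%N ->
  return_prob (fun=> 2^-1) n (j.*2%:Z - n%:Z) = 'C(n, j)%:R / 2 ^+ n.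
Proof.
have far m y : (m%:Z < `|y|)%R -> return_prob (fun=> 2^-1) m y = 0 :> R.
  elim: m y => [|m IH] y /= hy; first by case: eqP hy => // ->.
  by rewrite !IH ?mulr0 ?addr0//; lia.
elim: n j => [|n IH] j jn.
  by move: jn; rewrite leqn0 => /eqP ->; rewrite (_ : 0.*2%:Z - 0%:Z = 0)//= bin0 expr0 divr1.
rewrite /= (_ : 1 - 2^-1 = 2^-1 :> R); last by lra.
rewrite exprS invfM mulrA; case: j jn => [_|j jn].
  rewrite [X in _ + _ * X]far ?mulr0 ?addr0; last by lia.
  rewrite (_ : 0.*2%:Z - n.+1%:Z + 1 = 0.*2%:Z - n%:Z); last lia.
  by rewrite IH// !bin0; ring.
rewrite (_ : j.+1.*2%:Z - n.+1%:Z - 1 = j.*2%:Z - n%:Z); last lia.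
rewrite (_ : j.+1.*2%:Z - n.+1%:Z + 1 = j.+1.*2%:Z - n%:Z); last lia.
rewrite (IH j)// binS natrD; have [jn'|jn'] := leqP j.+1 n.
  by rewrite IH//; ring.
rewrite far; last by lia.
by rewrite ['C(n, j.+1)]bin_small//; ring.
Qed.

(** An elementary substitute for Stirling's formula: [n] times the squared return probability at
    time [2 n] is nondecreasing in [n], and it equals [1/4] at [n = 1]. *)
Lemma return_prob_half_ge n : (0 < n)%N ->
  1 <= 4 * n%:R * return_prob (fun=> 2^-1) n.*2 0 ^+ 2 :> R.
Proof.
have e m : return_prob (fun=> 2^-1) m.*2 0 = 'C(m.*2, m)%:R / 2 ^+ m.*2 :> R.
  rewrite -return_prob_half; last lia.
  by congr return_prob; lia.
have step m : (return_prob (fun=> 2^-1) m.+1.*2 0 : R) =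
    return_prob (fun=> 2^-1) m.*2 0 * ((2 * m%:R + 1) / (2 * (m%:R + 1))).
  rewrite !e.
  have h : ('C(m.+1.*2, m.+1) * m.+1 = 'C(m.*2, m) * (m.*2.+1).*2)%N.
    have h1 := mul_bin_diag m.*2.+2 m; have h2 := mul_bin_down m.*2.+1 m.
    rewrite (_ : m.*2.+1 - m = m.+1)%N in h2; last lia.
    rewrite /= in h1 h2; rewrite doubleS; nia.
  have {}h : 'C(m.+1.*2, m.+1)%:R * (m%:R + 1) = 'C(m.*2, m)%:R * (2 * (2 * m%:R + 1)) :> R.
    rewrite natr1 -natrM h natrM -!muln2 natrM -natr1 natrM; congr (_ * _); ring.
  have m1 : (m%:R + 1 : R) != 0 by rewrite natr1 pnatr_eq0.
  rewrite doubleS !exprS -[in LHS](mulfK m1 'C(_, _)%:R) h.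
  by field; rewrite m1 expf_neq0.
case: n => // n _; elim: n => [|n IH].
  by rewrite /=; lra.
rewrite step; apply: (le_trans IH); set q := return_prob _ _ _.
have n0 : 0 <= n%:R :> R by [].
rewrite exprMn -!natr1 -subr_ge0.
set N : R := n%:R in n0 *.
rewrite (_ : _ - _ = q ^+ 2 / (N + 1 + 1)); last by field; lra.
by rewrite divr_ge0 ?sqr_ge0//; lra.
Qed.

End nearest_neighbour_walk.

(** With [A = a + b] and [N] the integer part of [D / 4], each of the times [2 n] with [0 < n <= N]
    contributes at least [1 / (8 A m)] times [1 / (2 sqrt N)]. The sum is thus at least
    [sqrt N / (16 A m)]. *)
Lemma sum_return_prob_unbounded (R : realType) (w E : int -> R) :
  (forall y, 0 < w y < 1) -> (forall y, 0 < E y) ->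
  (forall y, E y * w y = E (y - 1) * (1 - w y)) -> E 0 = 1 ->
  (forall K : R, exists (a b : nat) (D m : R),
    [/\ (0 < b)%N, D <= E (b%:Z - 1), D <= E (- a.+1%:Z),
        0 < m /\ (forall y, - a.+1%:Z <= y < b%:Z -> (E y)^-1 <= m) &
        K * (a + b)%:R * m <= Num.sqrt D]) ->
  forall K : R, exists N : nat,
    K <= \sum_(0 <= n < N) return_prob w n.*2 0 * return_prob (fun=> 2^-1) n.*2 0.
Proof.
move=> w01 Epos Erec E0 deep K.
pose K' := Num.max K 1.
have K1 : 1 <= K' by rewrite le_max lexx orbT.
(* [48 = 16 * 3]: the [16] is that of the summand bound, the [3] is lost in [sqrt D <= 3 * sqrt N].
   Having [1 <= K'] makes [D] large enough for this rounding. *)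
have [a [b [D [m [b0 Db Da [m0 Em] KD]]]]] := deep (48 * K').
set A : R := (a + b)%:R in KD.
have A1 : 1 <= A by rewrite ler1n; lia.
have m1 : 1 <= m by have := Em 0; rewrite E0 invr1; apply; lia.
have Am : 1 <= A * m by nra.
have KAm : 48 <= 48 * K' * A * m.
  have := ler_pM (ler01) (ler01) K1 Am; rewrite mulr1; lra.
have D48 : 48 <= Num.sqrt D by lra.
have D0 : 0 <= D by rewrite leNgt; apply/negP => /ltW/ler0_sqrtr D0; rewrite D0 in D48; lra.
have sD : Num.sqrt D ^+ 2 = D by rewrite sqr_sqrtr.
pose N := Num.truncn (D / 4).
have /andP[N1 N2] : N%:R <= D / 4 < N.+1%:R by rewrite truncn_itv// divr_ge0.
exists N.+1.
pose s : R := Num.sqrt N%:R.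
have sN : s ^+ 2 = N%:R by rewrite sqr_sqrtr.
have s0 : 0 <= s by rewrite sqrtr_ge0.
have sDs : Num.sqrt D <= 3 * s.
  have N2' : D / 4 < s ^+ 2 + 1 by rewrite sN natr1.
  rewrite leNgt; apply/negP => lt; move: N2'; rewrite -sD; nra.
have s1 : 1 <= s by lra.
have q0 n : 0 <= return_prob (fun=> 2^-1) n 0 :> R.
  by apply: return_prob_ge0 => _; apply/andP; split; lra.
have term n : (0 < n < N.+1)%N -> (16 * A * m * s)^-1 <=
    return_prob w n.*2 0 * return_prob (fun=> 2^-1) n.*2 0.
  move=> /andP[n0 nN].
  have nNR : n%:R <= N%:R :> R by rewrite ler_nat.
  have p1 : 1 <= 8 * A * m * return_prob w n.*2 0.
    by apply: (return_prob_ge_valley w01 Epos Erec E0 b0 Db Da m0 Em); lra.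
  have := @return_prob_half_ge R n n0; have := q0 n.*2.
  set q := return_prob (fun=> _) _ _ => {}q0 hq.
  have q1 : 1 <= 2 * s * q.
    rewrite leNgt; apply/negP => lt.
    have : (2 * s * q) ^+ 2 < 1 by rewrite expr_lt1// mulr_ge0// mulr_ge0.
    rewrite !exprMn sN; have := ler_wpM2r (sqr_ge0 q) nNR; lra.
  rewrite -div1r ler_pdivrMr; last by rewrite !mulr_gt0//; lra.
  have := ler_pM (ler01) (ler01) p1 q1; lra.
apply: (@le_trans _ _ K'); first by rewrite le_max lexx.
rewrite big_nat_recl//.
apply: (@le_trans _ _ (\sum_(0 <= i < N) (16 * A * m * s)^-1)).
  rewrite big_const_nat subn0 iter_addr_0 -[leRHS]mulr_natl -sN ler_pdivlMr; last by rewrite !mulr_gt0//; lra.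
  have h : 16 * K' * A * m <= s by lra.
  by have := ler_wpM2r s0 h; lra.
apply: ler_wpDl; first by apply: mulr_ge0; [exact: return_prob_ge0 | exact: q0].
by apply: ler_sum_nat => i iN; exact: term.
Qed.

(** * Recurrence of Markov chains *)

Section measurable_quantifiers.
Context d (T : measurableType d).

Lemma measurable_forall_nat (P : nat -> T -> Prop) :
  (forall i, measurable [set t | P i t]) -> measurable [set t | forall i, P i t].
Proof.
move=> mP; rewrite (_ : [set t | _] = \bigcap_i [set t | P i t]).
  exact: bigcap_measurable.
by apply/seteqP; split => t H i => [_|]; exact: (H i).
Qed.

Lemma measurable_impl (b : Prop) (A : set T) : measurable A -> measurable [set t | b -> A t].
Proof.
move=> mA; have [hb|hb] := pselect b.
  by rewrite (_ : [set t | _] = A)//; apply/seteqP; split => t //=; apply.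
by rewrite (_ : [set t | _] = setT)//; apply/seteqP; split => t //=.
Qed.

Lemma measurable_exists_nat (Q : nat -> T -> Prop) :
  (forall i, measurable [set t | Q i t]) -> measurable [set t | exists i, Q i t].
Proof.
move=> mQ; rewrite (_ : [set t | _] = \bigcup_i [set t | Q i t]).
  exact: bigcup_measurable.
by apply/seteqP; split => t [i]; exists i.
Qed.

End measurable_quantifiers.

(** Reduces a proportionality of two probabilities to the level sets of countably valued
    observables, possibly different ones on the two sides. [pickle] indexes the levels by [nat]; a
    number that codes no value gives the empty set. *)
Lemma measure_countable_partition d (T : measurableType d) (R : realType)
    (Q : probability T R) (S : countType) (f g : T -> S) (A B : set T) (c : R) :
  0 <= c ->
  (forall v, measurable (A `&` f @^-1` [set v])) ->
  (forall v, measurable (B `&` g @^-1` [set v])) ->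
  (forall v, Q (A `&` f @^-1` [set v]) = (c%:E * Q (B `&` g @^-1` [set v]))%E) ->
  Q A = (c%:E * Q B)%E.
Proof.
move=> c0 mf mg fg.
pose F (h : T -> S) (C : set T) n := C `&` [set t | pickle (h t) = n].
have FU h C : C = \bigcup_n F h C n.
  by apply/seteqP; split => [t Ct|t [n _ []]//]; exists (pickle (h t)).
have FE h C n : F h C n = (if pickle_inv n is Some v then C `&` h @^-1` [set v] else set0).
  case E : (pickle_inv n) => [v|].
    have := @pickle_invK S n; rewrite E /= => <-.
    apply/seteqP; split => t [Ct /=].
      by move=> /(pcan_inj pickleK) ->.
    by move=> e; split => //=; rewrite e.
  apply/seteqP; split => t // [_ /= e].
  by move: E; rewrite -e pickleK_inv.
have mF h C n : (forall v, measurable (C `&` h @^-1` [set v])) -> measurable (F h C n).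
  by move=> H; rewrite FE; case: pickle_inv.
have tF h C : trivIset setT (F h C).
  by move=> i j _ _ [t [[_ /= <-] [_ /= <-]]].
rewrite (FU f A) (FU g B) !measure_bigcup//; last 2 first.
- by move=> n _; exact: mF.
- by move=> n _; exact: mF.
rewrite -nneseriesZl//; apply: eq_eseriesr => n _.
by rewrite !FE; case: (pickle_inv n) => [v|]; [exact: fg | rewrite !measure0 mule0].
Qed.

Section markov_recurrence.
Context d (T : measurableType d) (R : realType) (Q : probability T R).
Variables (S : countType) (Z : nat -> T -> S) (s0 : S) (K : S -> S -> R).
Hypothesis K0 : forall s s', 0 <= K s s'.
Hypothesis mZ : forall n (A : set S), measurable (Z n @^-1` A).
Hypothesis Z0 : Q [set t | Z 0%N t = s0] = 1%E.

(** The trajectory is a full sequence of which the first [n.+1] entries are read. The Markov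
    property can then be the product rule [ZK], free of conditioning on null events. *)
Definition cylinder (n : nat) (x : nat -> S) :=
  [set t | forall i, (i <= n)%N -> Z i t = x i].

Hypothesis ZK : forall n x,
  Q (cylinder n.+1 x) = (Q (cylinder n x) * (K (x n) (x n.+1))%:E)%E.

Definition path_weight (m : nat) (l : nat -> S) : R := \prod_(i < m) K (l i) (l i.+1).

Lemma cylinder_path_weight n m x :
  Q (cylinder (n + m) x) = (Q (cylinder n x) * (path_weight m (fun i => x (n + i)%N))%:E)%E.
Proof.
elim: m => [|m IH]; first by rewrite addn0 /path_weight big_ord0 mule1.
by rewrite addnS ZK IH /path_weight big_ord_recr/= EFinM addnS muleA.
Qed.

Lemma measurable_mkseq (k : nat -> nat) m (v : seq S) :
  measurable [set t | mkseq (fun i => Z (k i) t) m = v].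
Proof.
have [sv|sv] := eqVneq (size v) m; last first.
  rewrite (_ : [set t | _] = set0)//; apply/seteqP; split => t //= e.
  by move: sv; rewrite -e size_mkseq eqxx.
rewrite (_ : [set t | _] = [set t | forall i, (i < m)%N -> Z (k i) t = nth s0 v i]).
  apply: measurable_forall_nat => i; apply: measurable_impl; exact: (mZ _ [set nth s0 v i]).
apply/seteqP; split => t /=.
  by move=> <- i im; rewrite nth_mkseq.
move=> H; apply: (@eq_from_nth _ s0); rewrite size_mkseq ?sv// => i im.
by rewrite nth_mkseq// H.
Qed.

Lemma measurable_path n m (l : nat -> S) :
  measurable [set t | forall i, (i <= m)%N -> Z (n + i)%N t = l i].
Proof.
apply: measurable_forall_nat => i; apply: measurable_impl.
exact: (mZ _ [set l i]).
Qed.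

(** Markov property at time [n]: summing over the first [n] positions, each past is glued to [l] and
    contributes the factor [path_weight m l]. *)
Lemma shifted_path_weight n m (l : nat -> S) : l 0%N = s0 ->
  Q [set t | forall i, (i <= m)%N -> Z (n + i)%N t = l i] =
  (Q [set t | Z n t = s0] * (path_weight m l)%:E)%E.
Proof.
move=> l0; pose past t := mkseq (fun i => Z i t) n.
have mC v : measurable ([set t | Z n t = s0] `&` past @^-1` [set v]).
  by apply: measurableI; [exact: (mZ _ [set s0]) | exact: (measurable_mkseq id)].
rewrite muleC.
apply: (@measure_countable_partition _ _ _ _ _ past past); rewrite ?lee_fin ?prodr_ge0//.
  move=> v; apply: measurableI; [exact: measurable_path | exact: (measurable_mkseq id)].
move=> v; have [sv|sv] := eqVneq (size v) n; last first.
  have e0 : past @^-1` [set v] = set0.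
    by apply/seteqP; split => t //= e; move: sv; rewrite -e size_mkseq eqxx.
  by rewrite e0 !setI0 !measure0 mule0.
pose x i := if (i < n)%N then nth s0 v i else l (i - n)%N.
have xn i : x (n + i)%N = l i by rewrite /x ltnNge leq_addr /= addKn.
have pastP t : past t = v <-> forall i, (i < n)%N -> Z i t = x i.
  split => [e i lin|H].
    by rewrite /x lin -e nth_mkseq.
  apply: (@eq_from_nth _ s0); rewrite size_mkseq ?sv// => i lin.
  by rewrite nth_mkseq// H// /x lin.
rewrite (_ : _ `&` _ = cylinder (n + m) x); last first.
  apply/seteqP; split => t /=.
    move=> [H /pastP Hp] i inm; have [lin|nin] := ltnP i n; first exact: Hp.
    by rewrite -(subnKC nin) H ?xn//; lia.
  move=> H; split; first by move=> i im; rewrite H ?xn//; lia.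
  by apply/pastP => i lin; apply: H; lia.
rewrite (_ : [set t | Z n t = s0] `&` _ = cylinder n x); last first.
  apply/seteqP; split => t /=.
    move=> [H /pastP Hp] i; rewrite leq_eqVlt => /orP[/eqP ->|]; last exact: Hp.
    by rewrite H -(addn0 n) xn l0.
  move=> H; split; first by rewrite H// -(addn0 n) xn l0.
  by apply/pastP => i lin; apply: H; lia.
by rewrite cylinder_path_weight muleC; congr ((path_weight _ _)%:E * _)%E; apply/funext.
Qed.

Definition no_return (n m : nat) := [set t | forall i, (0 < i <= m)%N -> Z (n + i)%N t <> s0].

Definition last_visit (n : nat) := [set t | Z n t = s0 /\ forall i, (0 < i)%N -> Z (n + i)%N t <> s0].

Lemma measurable_visit n : measurable [set t | Z n t = s0].
Proof. exact: (mZ n [set s0]). Qed.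

Lemma measurable_no_return n m : measurable (no_return n m).
Proof.
apply: measurable_forall_nat => i; apply: measurable_impl.
exact: (mZ _ [set s | s <> s0]).
Qed.

(** Renewal at a visit: splitting by the [m.+1] positions from the visit on, each admissible future
    has the same weight whether it starts at time [n] or at time [0]. *)
Lemma visit_no_return n m :
  Q ([set t | Z n t = s0] `&` no_return n m) =
  (Q [set t | Z n t = s0] * Q ([set t | Z 0%N t = s0] `&` no_return 0 m))%E.
Proof.
pose future k t := mkseq (fun i => Z (k + i)%N t) m.+1.
have mV k := measurableI _ _ (measurable_visit k) (measurable_no_return k m).
rewrite -[Q [set t | Z n t = s0]]fineK; last by rewrite fin_num_measure//; exact: measurable_visit.
apply: (@measure_countable_partition _ _ _ _ _ (future n) (future 0%N)) => [|v|v|v].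
- by rewrite fine_ge0.
- by apply: measurableI => //; exact: (measurable_mkseq (fun i => n + i)%N).
- by apply: measurableI => //; exact: (measurable_mkseq (fun i => 0 + i)%N).
have [[sv v0 vi]|nv] := pselect [/\ size v = m.+1, nth s0 v 0 = s0 &
    forall i, (0 < i <= m)%N -> nth s0 v i <> s0]; last first.
  suff e0 k : [set t | Z k t = s0] `&` no_return k m `&` future k @^-1` [set v] = set0.
    by rewrite !e0 measure0 mule0.
  apply/seteqP; split => t //= -[[Zk av] fv]; apply: nv; rewrite -fv size_mkseq; split => //.
    by rewrite nth_mkseq// addn0.
  by move=> i im; rewrite nth_mkseq; [exact: av | lia].
have e k : [set t | Z k t = s0] `&` no_return k m `&` future k @^-1` [set v] =
    [set t | forall i, (i <= m)%N -> Z (k + i)%N t = nth s0 v i].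
  apply/seteqP; split => t /=.
    by move=> [_ <-] i im; rewrite nth_mkseq.
  move=> H; split; [split|].
  - by rewrite -(addn0 k) H.
  - by move=> i im; rewrite H; [exact: vi | lia].
  - apply: (@eq_from_nth _ s0); rewrite size_mkseq ?sv// => i im.
    by rewrite nth_mkseq// H.
rewrite !e !shifted_path_weight// Z0 mul1e fineK//.
by rewrite fin_num_measure//; exact: measurable_visit.
Qed.

Lemma measurable_last_visit n : measurable (last_visit n).
Proof.
rewrite /last_visit (_ : [set t | _] = [set t | Z n t = s0] `&`
   [set t | forall i, (0 < i)%N -> Z (n + i)%N t <> s0])//.
apply: measurableI; first exact: measurable_visit.
apply: measurable_forall_nat => i; apply: measurable_impl.
exact: (mZ _ [set s | s <> s0]).
Qed.

(** Limit of [visit_no_return] as [m] grows, by continuity from above. *)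
Lemma last_visit_factor n :
  Q (last_visit n) = (Q [set t | Z n t = s0] * Q (last_visit 0))%E.
Proof.
have mV k m : measurable ([set t | Z k t = s0] `&` no_return k m).
  by apply: measurableI; [exact: measurable_visit | exact: measurable_no_return].
have cvg k : Q ([set t | Z k t = s0] `&` no_return k m) @[m --> \oo] --> Q (last_visit k).
  rewrite (_ : last_visit k = \bigcap_m ([set t | Z k t = s0] `&` no_return k m)); last first.
    apply/seteqP; split => t /=.
      by move=> [Zk H] m _; split => // i /andP[i0 _]; exact: H.
    move=> H; split; first by have [] := H 0%N I.
    by move=> i i0; have [_] := H i I; apply; rewrite i0/=.
  apply: nonincreasing_cvg_mu.
  - by rewrite -ge0_fin_numE// fin_num_measure.
  - by [].
  - by apply: bigcap_measurable.
  - move=> m m' mm'; apply/subsetPset => t [Zk H]; split => // i /andP[i0 im].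
    by apply: H; rewrite i0 (leq_trans im).
have := cvg n; under eq_fun do rewrite visit_no_return.
move=> /cvg_lim <-//; apply/cvg_lim => //.
by apply: cvgeZl => //; rewrite fin_num_measure//; exact: measurable_visit.
Qed.

Lemma trivIset_last_visit : trivIset setT last_visit.
Proof.
apply: ltn_trivIset => i j ji; apply/seteqP; split => t //= -[[_ H] [Zi _]].
have := H (i - j)%N; rewrite subn_gt0 subnKC; last exact: ltnW.
by move=> /(_ ji).
Qed.

(* The events [last_visit n] are disjoint, with probabilities
   [Q (Z n = s0) * Q (last_visit 0)]; so if the probabilities of the visits
   have an infinite sum, then [Q (last_visit 0) = 0]. *)
Lemma markov_recurrent :
  (forall C : R, exists N, (C%:E <= \sum_(0 <= n < N) Q [set t | Z n t = s0])%E) ->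
  {ae Q, forall t, infinite_set [set n | Z n t = s0]}.
Proof.
move=> unb.
have lv0 : Q (last_visit 0) = 0%E.
  apply/eqP; apply/negP => /negP lv0.
  have fl : Q (last_visit 0) \is a fin_num by rewrite fin_num_measure//; exact: measurable_last_visit.
  have lgt : (0 < fine (Q (last_visit 0)))%R.
    by rewrite fine_gt0// lt0e lv0 measure_ge0/= -ge0_fin_numE.
  (* Chosen so that the disjoint events [last_visit n] with [n < N] would have total probability at
     least [2]. *)
  have [N hN] := unb (2 / fine (Q (last_visit 0))).
  have : (\sum_(0 <= n < N) Q (last_visit n) <= 1)%E.
    rewrite big_mkord -(@measure_bigsetU _ _ _ Q) //; last 2 first.
      by move=> i; exact: measurable_last_visit.
      exact: trivIset_last_visit.
    by apply: probability_le1; apply: bigsetU_measurable => i _; exact: measurable_last_visit.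
  under eq_bigr do rewrite last_visit_factor.
  rewrite -ge0_sume_distrl//.
  have := lee_wpmul2r (measure_ge0 Q (last_visit 0)) hN => /le_trans/[apply].
  rewrite -[X in (_ * X)%E](fineK fl) -EFinM lee_fin divfK ?gt_eqF//; lra.
have lvn n : Q (last_visit n) = 0%E by rewrite last_visit_factor lv0 mule0.
have neg0 : Q.-negligible (\bigcup_n last_visit n).
  apply: negligible_bigcup => n; exists (last_visit n).
  by split; [exact: measurable_last_visit | exact: lvn | by []].
have neg1 : Q.-negligible (~` [set t | Z 0%N t = s0]).
  exists (~` [set t | Z 0%N t = s0]); split => //; first by apply: measurableC; exact: measurable_visit.
  by rewrite probability_setC ?Z0 ?subee//; exact: measurable_visit.
(* A trajectory that starts at [s0] and visits it finitely often has a last visit, hence lies in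
   some [last_visit n]. *)
apply: negligibleS (negligibleU neg0 neg1) => t /= fin.
have [Z0t|] := pselect (Z 0%N t = s0); last by right.
left; have {}fin : finite_set [set n | Z n t = s0] by apply: contrapT => nf; exact: fin.
have [X XE] := (finite_seqP _).1 fin.
have bX n : Z n t == s0 -> (n <= \max_(i <- X) i)%N.
  move=> /eqP Zn; apply: (@leq_bigmax_seq _ X xpredT id) => //=.
  by have : [set n | Z n t = s0] n by []; rewrite XE.
have ex : exists n, Z n t == s0 by exists 0%N; apply/eqP.
case: (ex_maxnP ex bX) => n /eqP Zn nmax; exists n => //; split => // i i0 Zi.
by have := nmax _ (introT eqP Zi); lia.
Qed.
End markov_recurrence.

(** * Independence *)

Section independence_of_sigma_algebras.
Context d (T : measurableType d) (R : realType) (P : probability T R).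

Lemma g_sigma_algebra_sub_measurable (G : set (set T)) :
  G `<=` measurable -> <<s G >> `<=` measurable.
Proof.
move=> GT; apply: smallest_sub => //; split => //.
- by move=> A mA; rewrite setTD; exact: measurableC.
- by move=> F mF; exact: bigcup_measurable.
Qed.

(** Dynkin's pi-lambda argument: the events independent of a fixed [B] are stable under complement
    and countable disjoint union. *)
Lemma independent_g_sigma_algebra (G : set (set T)) (B : set T) :
  setI_closed G -> G `<=` measurable -> measurable B ->
  (forall A, G A -> P (A `&` B) = (P A * P B)%E) ->
  forall A, <<s G >> A -> P (A `&` B) = (P A * P B)%E.
Proof.
move=> GI Gm mB GB A sA.
have sm := g_sigma_algebra_sub_measurable Gm.
pose TG : measurableType _ := g_sigma_algebraType G.
apply: (@dynkin_induction _ TG G (fun A => P (A `&` B) = (P A * P B)%E)) => //.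
- by rewrite setTI probability_setT mul1e.
- move=> S /sm mS /= e; rewrite probability_setC// setIC -setDE measureD//; last first.
    by rewrite -ge0_fin_numE// fin_num_measure.
  rewrite setIC [X in (_ - X)%E]e muleBl ?mul1e//.
  by rewrite fin_num_measure.
- move=> F /= mF tF FB; have mF' n := sm _ (mF n).
  rewrite setI_bigcupl !measure_bigcup//; last 2 first.
    by move=> n _; exact: measurableI.
    by apply: trivIset_setIr.
  rewrite muleC -(fineK (fin_num_measure P _ mB)) -nneseriesZl//.
  by apply: eq_eseriesr => n _; rewrite fineK ?fin_num_measure// muleC; exact: FB.
Qed.

Lemma independent_g_sigma_algebra2 (G1 G2 : set (set T)) :
  setI_closed G1 -> setI_closed G2 -> G1 `<=` measurable -> G2 `<=` measurable ->
  (forall A B, G1 A -> G2 B -> P (A `&` B) = (P A * P B)%E) ->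
  forall A B, <<s G1 >> A -> <<s G2 >> B -> P (A `&` B) = (P A * P B)%E.
Proof.
move=> I1 I2 m1 m2 H A B sA sB.
have mA := g_sigma_algebra_sub_measurable m1 sA.
rewrite setIC muleC; apply: (independent_g_sigma_algebra I2 m2 mA _ sB) => B' GB'.
rewrite setIC muleC.
by apply: (independent_g_sigma_algebra I1 m1 (m2 _ GB') _ sA) => A' GA'; exact: H.
Qed.
End independence_of_sigma_algebras.

(** * Independence of disjoint groups of coordinates *)

Section grouping.
Context d d' (T : measurableType d) (S : measurableType d') (R : realType).
Variables (P : probability T R) (I : eqType) (Z : I -> T -> S).
Hypothesis mZ : forall i, measurable_fun setT (Z i).
Hypothesis indepZ : mutually_independent P Z.

Definition coordinate_events (J : set I) : set (set T) :=
  [set A | exists i (B : set S), [/\ J i, measurable B & A = Z i @^-1` B]].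

(** Unlike [coordinate_events], this family is closed under intersection, and mutual independence
    speaks directly of its members. *)
Definition coordinate_cylinders (J : set I) : set (set T) :=
  [set A | exists (s : seq I) (B : I -> set S), [/\ uniq s,
    (forall i, i \in s -> J i), (forall i, i \in s -> measurable (B i)) &
    A = \bigcap_(i in [set` s]) (Z i @^-1` B i)]].

Lemma measurable_coordinate i (B : set S) : measurable B -> measurable (Z i @^-1` B).
Proof. by move=> mB; rewrite -[X in measurable X]setTI; exact: mZ. Qed.

Lemma coordinate_cylinders_measurable J : coordinate_cylinders J `<=` measurable.
Proof.
move=> _ [s [B [_ _ mB ->]]]; apply: fin_bigcap_measurable => [|i si]; first exact: finite_seq.
exact/measurable_coordinate/mB.
Qed.

Lemma coordinate_events_measurable J : coordinate_events J `<=` measurable.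
Proof. by move=> _ [i [B [_ mB ->]]]; exact: measurable_coordinate. Qed.

Lemma coordinate_cylinders_setI J : setI_closed (coordinate_cylinders J).
Proof.
move=> _ _ [s1 [B1 [u1 J1 m1 ->]]] [s2 [B2 [u2 J2 m2 ->]]].
exists (undup (s1 ++ s2)).
(* The two index lists may overlap; [setT] stands for an absent constraint. *)
exists (fun i => (if i \in s1 then B1 i else setT) `&` (if i \in s2 then B2 i else setT)).
split; first exact: undup_uniq.
- by move=> i; rewrite mem_undup mem_cat => /orP[/J1|/J2].
- move=> i _; apply: measurableI; case: ifPn => //; [exact: m1 | exact: m2].
apply/seteqP; split => t /=.
  move=> [H1 H2] i _ /=; split; case: ifPn => // si; [exact: H1 | exact: H2].
move=> H; split => i /= si.
  by have [] := H i; rewrite /= ?mem_undup ?mem_cat ?si.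
by have [] := H i; rewrite /= ?mem_undup ?mem_cat ?si ?orbT.
Qed.

Lemma coordinate_cylinders_indep (J1 J2 : set I) (A B : set T) : [disjoint J1 & J2] ->
  coordinate_cylinders J1 A -> coordinate_cylinders J2 B -> P (A `&` B) = (P A * P B)%E.
Proof.
move=> /disj_setPLR J12 [s1 [B1 [u1 S1 m1 ->]]] [s2 [B2 [u2 S2 m2 ->]]].
pose C i := if i \in s1 then B1 i else B2 i.
have s12 i : i \in s2 -> i \in s1 = false.
  by move=> s2i; apply/negP => /S1 /J12; apply; exact: S2.
have e1 : \bigcap_(i in [set` s1]) (Z i @^-1` B1 i) = \bigcap_(i in [set` s1]) (Z i @^-1` C i).
  by apply: eq_bigcapr => i /= si; rewrite /C si.
have e2 : \bigcap_(i in [set` s2]) (Z i @^-1` B2 i) = \bigcap_(i in [set` s2]) (Z i @^-1` C i).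
  by apply: eq_bigcapr => i /= si; rewrite /C s12.
have mC1 i : i \in s1 -> measurable (C i) by rewrite /C => si; rewrite si; exact: m1.
have mC2 i : i \in s2 -> measurable (C i) by rewrite /C => si; rewrite s12//; exact: m2.
rewrite e1 e2 !indepZ// -big_cat -indepZ.
- congr (P _); apply/seteqP; split => t /=.
    by move=> [H1 H2] i /=; rewrite mem_cat => /orP[/H1|/H2].
  by move=> H; split => i /= si; apply: H => /=; rewrite mem_cat si ?orbT.
- rewrite cat_uniq u1 u2 andbT; apply/hasPn => i s2i; exact/negbT/s12.
- by move=> i; rewrite mem_cat => /orP[/mC1|/mC2].
Qed.

Lemma coordinate_events_indep (J1 J2 : set I) (A B : set T) : [disjoint J1 & J2] ->
  <<s coordinate_events J1 >> A -> <<s coordinate_events J2 >> B ->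
  P (A `&` B) = (P A * P B)%E.
Proof.
move=> J12.
have sub J : <<s coordinate_events J >> `<=` <<s coordinate_cylinders J >>.
  apply: sub_sigma_algebra2; move=> _ [i [C [Ji mC ->]]].
  exists [:: i], (fun=> C); split => //.
  - by move=> j; rewrite inE => /eqP ->.
  - by rewrite set_cons1 bigcap_set1.
move=> /sub sA /sub sB.
by apply: (independent_g_sigma_algebra2 _ _ _ _ _ sA sB);
  try exact: coordinate_cylinders_setI; try exact: coordinate_cylinders_measurable;
  move=> ? ?; exact: coordinate_cylinders_indep.
Qed.
End grouping.

(** * Real-valued expectations of bounded random variables *)

Section bounded_expectation.
Context d (T : measurableType d) (R : realType) (P : probability T R).

Definition bounded_mfun (f : T -> R) :=
  measurable_fun setT f /\ exists C, forall t, `|f t| <= C.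

Lemma bounded_mfun_integrable f : bounded_mfun f -> P.-integrable setT (EFin \o f).
Proof.
move=> [mf [C fC]]; apply: measurable_bounded_integrable => //.
  by rewrite -ge0_fin_numE// fin_num_measure.
by exists C; split; [exact: num_real | move=> x Cx t _; exact: le_trans (fC t) (ltW Cx)].
Qed.

Lemma bounded_mfunD f g : bounded_mfun f -> bounded_mfun g -> bounded_mfun (fun t => f t + g t).
Proof.
move=> [mf [C fC]] [mg [D gD]]; split; first exact: measurable_funD.
by exists (C + D) => t; rewrite (le_trans (ler_normD _ _))// lerD.
Qed.

Lemma bounded_mfunM f g : bounded_mfun f -> bounded_mfun g -> bounded_mfun (fun t => f t * g t).
Proof.
move=> [mf [C fC]] [mg [D gD]]; split; first exact: measurable_funM.
by exists (C * D) => t; rewrite normrM ler_pM.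
Qed.

Lemma bounded_mfun_cst c : bounded_mfun (fun=> c).
Proof. by split; [exact: measurable_cst | exists `|c|]. Qed.

Lemma bounded_mfun_indic A : measurable A -> bounded_mfun \1_A.
Proof.
move=> mA; split; first exact: measurable_indic.
by exists 1 => t; rewrite indicE; case: (t \in A); rewrite ?normr1 ?normr0.
Qed.

Definition mean (f : T -> R) : R := \int[P]_t f t.

Lemma mean_indic A : measurable A -> mean \1_A = fine (P A).
Proof.
by move=> mA; rewrite /mean /Rintegral integral_indic// setIT.
Qed.

Lemma mean_cst c : mean (fun=> c) = c.
Proof. 
rewrite /mean Rintegral_cst//; have PT : fine (P setT) = 1 by rewrite probability_setT.
by transitivity (c * 1); [congr (_ * _); exact: PT | rewrite mulr1].
Qed.

Lemma meanD f g : bounded_mfun f -> bounded_mfun g ->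
  mean (fun t => f t + g t) = mean f + mean g.
Proof. by move=> bf bg; rewrite /mean RintegralD//; exact: bounded_mfun_integrable. Qed.

Lemma meanZ c f : bounded_mfun f -> mean (fun t => c * f t) = c * mean f.
Proof. by move=> bf; rewrite /mean RintegralZl//; exact: bounded_mfun_integrable. Qed.

Lemma mean_le f g : bounded_mfun f -> bounded_mfun g -> (forall t, f t <= g t) ->
  mean f <= mean g.
Proof.
by move=> bf bg fg; apply: le_Rintegral => //; exact: bounded_mfun_integrable.
Qed.

(** Independence makes the joint law the product of the marginals, and Tonelli's theorem splits the
    integral. *)
Lemma ge0_mean_mul_indep U W : bounded_mfun U -> bounded_mfun W ->
  (forall t, 0 <= U t) -> (forall t, 0 <= W t) ->
  (forall A B : set R, measurable A -> measurable B ->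
    P (U @^-1` A `&` W @^-1` B) = (P (U @^-1` A) * P (W @^-1` B))%E) ->
  mean (fun t => U t * W t) = mean U * mean W.
Proof.
move=> bU bW U0 W0 ind.
have [[mU _] [mW _]] := (bU, bW).
pose RU : {RV P >-> R} := mfun_Sub (mem_set mU : U \in mfun).
pose RW : {RV P >-> R} := mfun_Sub (mem_set mW : W \in mfun).
have mUW : measurable_fun setT (fun t => (U t, W t)) by exact/measurable_fun_pairP.
rewrite /mean /Rintegral -fineM; last 2 first.
  by apply: integrable_fin_num => //; exact: bounded_mfun_integrable.
  by apply: integrable_fin_num => //; exact: bounded_mfun_integrable.
congr fine.
(* The absolute values make the integrand nonnegative on the whole plane, without changing it on the
   range of [(U, W)]. *)
pose f (z : R * R) : \bar R := (`|z.1| * `|z.2|)%:E.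
have f0 z : (0 <= f z)%E by rewrite lee_fin mulr_ge0.
have mf : measurable_fun setT f.
  by apply/measurable_EFinP; apply: measurable_funM; apply: measurableT_comp.
pose RP : {RV P >-> (R * R)%type} := mfun_Sub (mem_set mUW : (fun t => (U t, W t)) \in mfun).
transitivity (\int[distribution P RP]_z f z)%E.
  rewrite ge0_integral_distribution//=.
  by apply: eq_integral => t _; rewrite /f/= !ger0_norm.
transitivity (\int[(distribution P RU \x distribution P RW)%E]_z f z)%E.
  apply: eq_measure_integral => A mA _; apply/esym; exact: product_measure_unique.
rewrite fubini_tonelli1// /fubini_F /f /=.
have mn : measurable_fun setT (fun y : R => `|y|%:E) by exact/measurable_EFinP.
transitivity (\int[distribution P RU]_x (`|x|%:E * \int[distribution P RW]_y `|y|%:E))%E.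
  apply: eq_integral => x _; rewrite -ge0_integralZl_EFin//.
rewrite ge0_integralZr//; last exact: integral_ge0.
rewrite !ge0_integral_distribution//=.
by congr (_ * _)%E; apply: eq_integral => t _; rewrite ger0_norm.
Qed.

(** Adding the bounds [C] and [D] makes both variables nonnegative; the extra terms cancel by
    linearity. *)
Lemma mean_mul_indep U W : bounded_mfun U -> bounded_mfun W ->
  (forall A B : set R, measurable A -> measurable B ->
    P (U @^-1` A `&` W @^-1` B) = (P (U @^-1` A) * P (W @^-1` B))%E) ->
  mean (fun t => U t * W t) = mean U * mean W.
Proof.
move=> bU bW ind; have [[mU [C UC]] [mW [D WD]]] := (bU, bW).
have bUC := bounded_mfunD bU (bounded_mfun_cst C).
have bWD := bounded_mfunD bW (bounded_mfun_cst D).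
have := @ge0_mean_mul_indep (fun t => U t + C) (fun t => W t + D) bUC bWD.
have h1 t : 0 <= U t + C by have := UC t; rewrite ler_norml => /andP[]; lra.
have h2 t : 0 <= W t + D by have := WD t; rewrite ler_norml => /andP[]; lra.
have tr (c : R) (A : set R) : measurable A -> measurable [set x | A (x + c)].
  move=> mA; rewrite -[X in measurable X]setTI.
  by apply: (measurable_funD (f := id) (g := cst c)) => //; exact: measurable_id.
move=> /(_ h1 h2 _).
rewrite !meanD ?mean_cst//; try exact: bounded_mfun_cst.
have -> : mean (fun t => (U t + C) * (W t + D)) =
    mean (fun t => U t * W t) + D * mean U + C * mean W + C * D.
  rewrite -(mean_cst (C * D)) -!meanZ// -!meanD;
    try by do ?[apply: bounded_mfunD | apply: bounded_mfunM | exact: bounded_mfun_cst | done].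
  by congr mean; apply/funext => t; ring.
move=> H; have {}H := H (fun A B mA mB => ind _ _ (tr C A mA) (tr D B mB)).
lra.
Qed.

End bounded_expectation.

(** * Gambler's ruin *)

Section adapted.
Context d d' (T : measurableType d) (S : measurableType d') (R : realType).
Variables (P : probability T R) (I : eqType) (Z : I -> T -> S).
Hypothesis mZ : forall i, measurable_fun setT (Z i).

(** Encoded by changing the measurable structure of the domain, so that the closure properties of
    measurable functions apply as they are. *)
Definition adapted (J : set I) (f : T -> R) :=
  measurable_fun (setT : set (g_sigma_algebraType (coordinate_events Z J))) f.

Lemma adapted_preimage J f (B : set R) : adapted J f -> measurable B ->
  <<s coordinate_events Z J >> (f @^-1` B).
Proof. by move=> mf mB; have := mf measurableT B mB; rewrite setTI. Qed.

Lemma adapted_measurable J f : adapted J f -> measurable_fun setT f.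
Proof.
move=> mf _ B mB; rewrite setTI.
exact: (g_sigma_algebra_sub_measurable (coordinate_events_measurable mZ (J := J)) (adapted_preimage mf mB)).
Qed.

Lemma adapted_coordinate J i (phi : S -> R) : J i -> measurable_fun setT phi ->
  adapted J (phi \o Z i).
Proof.
move=> Ji mphi _ B mB; rewrite setTI; apply: sub_sigma_algebra.
exists i, (phi @^-1` B); split => //.
by rewrite -[X in measurable X]setTI; exact: mphi.
Qed.

End adapted.

(** * Optional stopping for a walk with independent, centred, bounded steps *)

Section gambler.
Context d d' (T : measurableType d) (S : measurableType d') (R : realType).
Variables (P : probability T R) (I : eqType) (Z : I -> T -> S).
Hypothesis mZ : forall i, measurable_fun setT (Z i).
Hypothesis indepZ : mutually_independent P Z.
Variables (k : nat -> I) (phi : S -> R) (C v l H : R).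
Hypothesis kinj : injective k.
Hypothesis mphi : measurable_fun setT phi.
Hypothesis phiC : forall s, `|phi s| <= C.

(** The order [k] of the sites and the function [phi] are left free: the same argument serves both
    sides of the origin, with opposite signs. *)
Definition step (i : nat) (t : T) : R := phi (Z (k i) t).
Definition walk (n : nat) (t : T) : R := \sum_(i < n) step i t.
Definition inside (n : nat) := [set t | forall j, (j <= n)%N -> - l < walk j t < H].
(** The walk frozen at its exit from the interval, as a martingale transform: the weight of step [i]
    is determined by the steps before it. *)
Definition stopped (n : nat) (t : T) : R := \sum_(i < n) step i t * \1_(inside i) t.
Definition exits_above (n : nat) := [set t | exists j, [/\ (j <= n)%N, H <= walk j t &
  forall i, (i < j)%N -> - l < walk i t]].

Definition sites (n : nat) : set I := [set k i | i in [set i | (i < n)%N]].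
Local Notation Fs n := (g_sigma_algebraType (coordinate_events Z (sites n))).

Lemma step_adapted i n : (i < n)%N -> adapted Z (sites n) (step i).
Proof. by move=> lin; apply: adapted_coordinate => //; exists i. Qed.

Lemma walk_adapted m n : (m <= n)%N -> adapted Z (sites n) (walk m).
Proof.
move=> mn; apply: (@measurable_sum _ (Fs n)) => i; apply: step_adapted.
exact: leq_trans (ltn_ord i) mn.
Qed.

Lemma inside_adapted m n : (m <= n)%N -> measurable (inside m : set (Fs n)).
Proof.
move=> mn; apply: measurable_forall_nat => j.
have [jm|jm] := leqP j m; last first.
  by rewrite (_ : [set t | _] = setT)//; apply/seteqP; split => t //=.
rewrite (_ : [set t | _] = walk j @^-1` `]- l, H[%classic); last first.
  by apply/seteqP; split => t /=; rewrite in_itv/= => h; [exact: h | move=> _].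
exact: (adapted_preimage (walk_adapted (leq_trans jm mn))).
Qed.

Lemma exits_above_adapted n : <<s coordinate_events Z (sites n) >> (exits_above n).
Proof.
apply: (@measurable_exists_nat _ (Fs n)) => j.
have [jn|jn] := leqP j n; last first.
  by rewrite (_ : [set t | _] = set0)//; apply/seteqP; split => t //= [].
rewrite (_ : [set t | _] = walk j @^-1` `[H, +oo[%classic `&`
    [set t | forall i, (i < j)%N -> (walk i @^-1` `]- l, +oo[%classic) t]); last first.
  apply/seteqP; split => t /=; rewrite in_itv/= ?andbT.
    by move=> [_ h1 h2]; split => // i ij; rewrite in_itv/= andbT h2.
  by move=> [h1 h2]; split => // i /h2; rewrite in_itv/= andbT.
apply: (@measurableI _ (Fs n)); first exact: (adapted_preimage (walk_adapted jn)).
apply: (@measurable_forall_nat _ (Fs n)) => i.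
have [ij|ij] := ltnP i j; last first.
  by rewrite (_ : [set t | _] = setT)//; apply/seteqP; split => t //=.
rewrite (_ : [set t | _] = walk i @^-1` `]- l, +oo[%classic); last first.
  by apply/seteqP; split => t /= h; [exact: h | move=> _].
exact: (adapted_preimage (walk_adapted (leq_trans (ltnW ij) jn))).
Qed.

Lemma stopped_adapted m n : (m <= n)%N -> adapted Z (sites n) (stopped m).
Proof.
move=> mn; apply: (@measurable_sum _ (Fs n)) => i.
have im := leq_trans (ltn_ord i) mn.
apply: (@measurable_funM _ (Fs n)); first exact: step_adapted.
by apply: (@measurable_indic _ (Fs n)); apply: inside_adapted; exact: ltnW.
Qed.

Lemma step_bounded i : bounded_mfun (step i).
Proof.
split; last by exists C => t; exact: phiC.
by apply: (adapted_measurable mZ (J := sites i.+1)); exact: step_adapted.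
Qed.

Lemma inside_measurable n : measurable (inside n).
Proof.
exact: (g_sigma_algebra_sub_measurable (coordinate_events_measurable mZ (J := sites n))
  (inside_adapted (leqnn n))).
Qed.

Lemma exits_above_measurable n : measurable (exits_above n).
Proof.
exact: (g_sigma_algebra_sub_measurable (coordinate_events_measurable mZ (J := sites n))
  (@exits_above_adapted n)).
Qed.

Hypothesis l0 : 0 < l.
Hypothesis H0 : l <= H.
Hypothesis C0 : 0 <= C.

Lemma stoppedS n t : stopped n.+1 t = stopped n t + step n t * \1_(inside n) t.
Proof. by rewrite /stopped big_ord_recr. Qed.

Lemma stopped_inside n t : inside n t -> stopped n t = walk n t /\ stopped n.+1 t = walk n.+1 t.
Proof.
have base m : inside m t -> stopped m t = walk m t.
  move=> ins; apply: eq_bigr => i _; rewrite indicE mem_set ?mulr1// => j ji.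
  by apply: ins; exact: leq_trans ji (ltnW (ltn_ord i)).
move=> ins; split; first exact: base.
by rewrite stoppedS base// indicE mem_set// mulr1 /walk big_ord_recr.
Qed.

Lemma stopped_outside n t : ~ inside n t -> stopped n.+1 t = stopped n t.
Proof. by move=> out; rewrite stoppedS indicE memNset// mulr0 addr0. Qed.

Lemma stopped_bound n t : `|stopped n t| <= H + C.
Proof.
elim: n => [|n IH]; first by rewrite /stopped big_ord0 normr0; move: l0 H0 C0; lra.
have [ins|out] := pselect (inside n t); last by rewrite stopped_outside.
have [_ ->] := stopped_inside ins; rewrite /walk big_ord_recr/= -/(walk n t).
have := ins n (leqnn n); have := phiC (Z (k n) t); rewrite -/(step n t) !ler_norml; move: l0 H0 C0; lra.
Qed.

Lemma stopped_bounded n : bounded_mfun (stopped n).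
Proof.
split; last by exists (H + C) => t; exact: stopped_bound.
by apply: (adapted_measurable mZ (J := sites n)); exact: stopped_adapted.
Qed.

Lemma stopped_trichotomy n t :
  [\/ stopped n t <= - l, exits_above n t | inside n t].
Proof.
elim: n => [|n IH].
  by apply: Or33 => j; rewrite leqn0 => /eqP ->; rewrite /walk big_ord0; move: l0 H0; lra.
have [ins|out] := pselect (inside n t); last first.
  rewrite stopped_outside//; case: IH => // [?|[j [jn Hj lj]]]; first exact: Or31.
  by apply: Or32; exists j; split => //; exact: leqW.
have [_ ->] := stopped_inside ins.
have [lo|lo] := leP (walk n.+1 t) (- l); first exact: Or31.
have [hi|hi] := leP H (walk n.+1 t).
  by apply: Or32; exists n.+1; split => // i; rewrite ltnS => /ins/andP[].
apply: Or33 => j; rewrite leq_eqVlt => /orP[/eqP ->|]; first by rewrite lo hi.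
by rewrite ltnS; exact: ins.
Qed.

(** Pointwise form of gambler's ruin: at most [- l] after an exit below, at most [H + C] (one step
    of overshoot) after an exit above, and below [H] while still inside. *)
Lemma stopped_le n t :
  stopped n t <= - l + (H + C + l) * \1_(exits_above n) t + (H + l) * \1_(inside n) t.
Proof.
have i1 : 0 <= \1_(exits_above n) t :> R by rewrite indicE.
have i2 : 0 <= \1_(inside n) t :> R by rewrite indicE.
have p1 : 0 <= (H + C + l) * \1_(exits_above n) t by rewrite mulr_ge0//; move: l0 H0 C0; lra.
have p2 : 0 <= (H + l) * \1_(inside n) t by rewrite mulr_ge0//; move: l0 H0 C0; lra.
case: (stopped_trichotomy n t) => [?|ex|ins]; first by lra.
  rewrite [\1_(exits_above n) t]indicE mem_set// mulr1.
  by have := stopped_bound n t; rewrite ler_norml => /andP[]; lra.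
have [-> _] := stopped_inside ins.
rewrite [\1_(inside n) t]indicE mem_set// mulr1.
by have := ins n (leqnn n); lra.
Qed.

Lemma past_step_indep n (U : T -> R) (psi : R -> R) : measurable_fun setT psi ->
  bounded_mfun U -> bounded_mfun (psi \o step n) ->
  adapted Z (sites n) U ->
  mean P (fun t => U t * psi (step n t)) = mean P U * mean P (psi \o step n).
Proof.
move=> mpsi bU bW aU; apply: mean_mul_indep => // A B mA mB.
apply: (coordinate_events_indep mZ indepZ (J1 := sites n) (J2 := [set k n])).
- apply/disj_setPS => i [[j /= jn <-]] /kinj jn'; by rewrite jn' ltnn in jn.
- exact: adapted_preimage.
- apply: (adapted_preimage (J := [set k n])) => //.
  by apply: (@adapted_coordinate _ _ _ _ _ _ Z [set k n] (k n) (psi \o phi)) => //; exact: measurableT_comp.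
Qed.

Hypothesis mean0 : forall i, mean P (step i) = 0.
Hypothesis var_step : forall i, mean P (fun t => step i t ^+ 2) = v.

Lemma indic_inside_bounded n : bounded_mfun (\1_(inside n) : T -> R).
Proof. exact/bounded_mfun_indic/inside_measurable. Qed.

Lemma step_sqr_bounded n : bounded_mfun (fun t => step n t ^+ 2).
Proof. by under eq_fun do rewrite expr2; apply: bounded_mfunM; exact: step_bounded. Qed.

Lemma mean_stopped n : mean P (stopped n) = 0.
Proof.
elim: n => [|n IH].
  rewrite (_ : stopped 0 = fun=> 0) ?mean_cst//.
  by apply/funext => t; rewrite /stopped big_ord0.
have -> : stopped n.+1 = fun t => stopped n t + \1_(inside n) t * step n t.
  by apply/funext => t; rewrite stoppedS mulrC.
rewrite meanD ?IH; [|exact: stopped_bounded|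
  by apply: bounded_mfunM; [exact: indic_inside_bounded | exact: step_bounded]].
rewrite (past_step_indep (psi := id)) ?mean0 ?mulr0 ?addr0//.
- exact: indic_inside_bounded.
- exact: step_bounded.
- by apply: (@measurable_indic _ (Fs n)); exact: inside_adapted.
Qed.

(** The cross term has mean zero, so each step taken inside adds [v]: the second moment is [v] times
    the expected time spent inside. *)
Lemma mean_stopped_sqr n :
  mean P (fun t => stopped n t ^+ 2) = v * \sum_(i < n) fine (P (inside i)).
Proof.
elim: n => [|n IH].
  rewrite big_ord0 mulr0 (_ : (fun t => _) = fun=> 0) ?mean_cst//.
  by apply/funext => t; rewrite /stopped big_ord0 expr0n.
have bMI : bounded_mfun (fun t => stopped n t * \1_(inside n) t).
  by apply: bounded_mfunM; [exact: stopped_bounded | exact: indic_inside_bounded].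
have -> : (fun t => stopped n.+1 t ^+ 2) = fun t => stopped n t ^+ 2 +
    (2 * (stopped n t * \1_(inside n) t * step n t) + \1_(inside n) t * step n t ^+ 2).
  apply/funext => t; rewrite stoppedS indicE.
  by case: (t \in inside n); rewrite /=; ring.
have b1 : bounded_mfun (fun t => stopped n t ^+ 2).
  by under eq_fun do rewrite expr2; apply: bounded_mfunM; exact: stopped_bounded.
have b2 : bounded_mfun (fun t => stopped n t * \1_(inside n) t * step n t).
  by apply: bounded_mfunM => //; exact: step_bounded.
have b3 : bounded_mfun (fun t => \1_(inside n) t * step n t ^+ 2).
  by apply: bounded_mfunM; [exact: indic_inside_bounded | exact: step_sqr_bounded].
have b2' : bounded_mfun (fun t => 2 * (stopped n t * \1_(inside n) t * step n t)).
  by apply: bounded_mfunM => //; exact: bounded_mfun_cst.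
rewrite meanD//; last exact: bounded_mfunD.
rewrite meanD// meanZ// IH.
rewrite (past_step_indep (psi := id))//; [|exact: step_bounded|]; last first.
  apply: (@measurable_funM _ (Fs n)); first exact: stopped_adapted.
  by apply: (@measurable_indic _ (Fs n)); exact: inside_adapted.
rewrite mean0 mulr0 mulr0 add0r.
rewrite (past_step_indep (psi := fun x => x ^+ 2)).
- rewrite [mean P (_ \o _)]var_step mean_indic; last exact: inside_measurable.
  by rewrite big_ord_recr/= mulrDr; congr (_ + _); rewrite mulrC.
- exact: measurable_funX.
- exact: indic_inside_bounded.
- exact: step_sqr_bounded.
- by apply: (@measurable_indic _ (Fs n)); exact: inside_adapted.
Qed.

Hypothesis v0 : 0 <= v.

(** The events [inside i] decrease with [i], so the expected time inside is at least [n] times the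
    last probability. *)
Lemma inside_prob_le n : n%:R * v * fine (P (inside n)) <= (H + C) ^+ 2.
Proof.
have b1 : bounded_mfun (fun t => stopped n t ^+ 2).
  by under eq_fun do rewrite expr2; apply: bounded_mfunM; exact: stopped_bounded.
apply: (@le_trans _ _ (mean P (fun t => stopped n t ^+ 2))); last first.
  rewrite -(mean_cst P ((H + C) ^+ 2)); apply: mean_le => //; first exact: bounded_mfun_cst.
  by move=> t; rewrite -[leLHS]real_normK ?num_real// lerXn2r// ?nnegrE//;
    [move: l0 H0 C0; lra | exact: stopped_bound].
rewrite mean_stopped_sqr mulrAC mulrC; apply: ler_wpM2l => //.
apply: (@le_trans _ _ (\sum_(i < n) fine (P (inside n)))).
  by rewrite sumr_const card_ord mulr_natl.
apply: ler_sum => i _; apply: fine_le; rewrite ?fin_num_measure//; try exact: inside_measurable.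
apply: le_measure; rewrite ?inE; try exact: inside_measurable.
by move=> t ins j ji; apply: ins; exact: leq_trans ji (ltnW (ltn_ord i)).
Qed.

Lemma exits_above_prob_ge n :
  l <= (H + C + l) * fine (P (exits_above n)) + (H + l) * fine (P (inside n)).
Proof.
have bE : bounded_mfun (fun t => (H + C + l) * \1_(exits_above n) t).
  by apply: bounded_mfunM; [exact: bounded_mfun_cst | exact/bounded_mfun_indic/exits_above_measurable].
have bI : bounded_mfun (fun t => (H + l) * \1_(inside n) t).
  by apply: bounded_mfunM; [exact: bounded_mfun_cst | exact: indic_inside_bounded].
have bl := @bounded_mfun_cst _ T _ (- l).
have := @mean_le _ _ _ P _ _ (stopped_bounded n) (bounded_mfunD (bounded_mfunD bl bE) bI)
  (stopped_le n).
rewrite mean_stopped meanD//; last exact: bounded_mfunD.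
rewrite meanD// mean_cst !meanZ; last 2 first.
- exact: indic_inside_bounded.
- exact/bounded_mfun_indic/exits_above_measurable.
rewrite !mean_indic; [lra | exact: inside_measurable | exact: exits_above_measurable].
Qed.

End gambler.

(** * The environment *)

Lemma mean_identically_distributed d d' (T : measurableType d) (S : measurableType d')
    (R : realType) (P : probability T R) (I : Type) (Z : I -> T -> S) (phi : S -> R) i j :
  (forall i, measurable_fun setT (Z i)) -> identically_distributed P Z ->
  bounded_mfun phi -> mean P (phi \o Z i) = mean P (phi \o Z j).
Proof.
move=> mZ idZ [mphi [C phiC]].
pose RZ i : {RV P >-> S} := mfun_Sub (mem_set (mZ i) : Z i \in mfun).
have mE : measurable_fun setT (EFin \o phi) by exact/measurable_EFinP.
have e k : (\int[P]_t ((phi \o Z k) t)%:E = \int[distribution P (RZ k)]_s (phi s)%:E)%E.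
  rewrite integral_distribution//; apply: bounded_mfun_integrable.
  by split; [exact: measurableT_comp | exists C => t; exact: phiC].
rewrite /mean /Rintegral; congr fine; rewrite !e.
by apply: eq_measure_integral => A mA _; exact: idZ.
Qed.

(** * The potential and its valleys *)

Section potential.
Context {R : realType}.
Implicit Types xi : int -> R.

(** Normalised to vanish at [0], with [xi y] the increment from [y - 1] to [y]. So the right branch
    reads the sites from [1] up, and the left branch those from [0] down. *)
Definition potential xi (y : int) : R :=
  match y with
  | Posz n => \sum_(i < n) xi i.+1%:Z
  | Negz n => - \sum_(i < n.+1) xi (- i%:Z)
  end.

Lemma potentialS xi y : potential xi y = potential xi (y - 1) + xi y.
Proof.
case: y => [[|n]|n].
- by rewrite /= big_ord0 big_ord_recr big_ord0/= add0r oppr0 addNr.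
- rewrite (_ : n.+1%:Z - 1 = n%:Z); last lia.
  by rewrite /= big_ord_recr.
- rewrite (_ : Negz n - 1 = Negz n.+1); last lia.
  by rewrite /= [in RHS]big_ord_recr/= opprD NegzE subrK.
Qed.

Lemma potential0 xi : potential xi 0 = 0. Proof. by rewrite /= big_ord0. Qed.

Lemma potential_right xi n j :
  potential xi (n + j)%N%:Z = potential xi n%:Z + \sum_(i < j) xi (n + i).+1%:Z.
Proof.
elim: j => [|j IH]; first by rewrite addn0 big_ord0 addr0.
rewrite addnS potentialS (_ : (n + j).+1%:Z - 1 = (n + j)%N%:Z); last lia.
by rewrite IH big_ord_recr/= addrA.
Qed.

Lemma potential_left xi n j :
  potential xi (- (n + j)%N%:Z) = potential xi (- n%:Z) + \sum_(i < j) - xi (- (n + i)%N%:Z).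
Proof.
elim: j => [|j IH]; first by rewrite addn0 big_ord0 addr0.
rewrite big_ord_recr/= addrA -IH [in RHS]potentialS addnS addrK.
by congr potential; lia.
Qed.

Lemma potential_norm xi C n : (forall y, `|xi y| <= C) ->
  `|potential xi n%:Z| <= C * n%:R /\ `|potential xi (- n%:Z)| <= C * n%:R.
Proof.
move=> xiC; have sumC (F : nat -> R) : (forall i, `|F i| <= C) ->
    `|\sum_(i < n) F i| <= C * n%:R.
  move=> FC; rewrite (le_trans (ler_norm_sum _ _ _))//.
  apply: (@le_trans _ _ (\sum_(i < n) C)); first exact: ler_sum.
  by rewrite sumr_const card_ord mulr_natr.
split.
  by have := potential_right xi 0 n; rewrite add0n potential0 add0r => ->; exact: (sumC (fun i => xi i.+1%:Z)).
have := potential_left xi 0 n; rewrite add0n (_ : - 0%:Z = 0)// potential0 add0r => ->.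
by apply: (sumC (fun i => - xi (- i%:Z))) => i; rewrite normrN.
Qed.

(* What matters for the constants is that [exp (15 l / 2)] beats
   [exp (2 l)] times any power of [l]. *)
Definition valley xi (n N l : nat) :=
  exists j j' : nat, [/\ (j <= N)%N, (0 < j' <= N)%N,
   15 * l%:R <= potential xi (n + j)%N%:Z /\ 15 * l%:R <= potential xi (- (n + j')%N%:Z)
   & forall y, - (n + j')%N%:Z <= y <= (n + j)%N%:Z -> - (2 * l%:R) <= potential xi y].

Lemma valley_sum_return_prob_unbounded (w : int -> R) (K : nat) :
  (forall y, 0 < w y < 1) ->
  (forall m : nat, exists n l, [/\ (m < l)%N, (n <= l)%N &
     valley (fun y => ln (rho w y)) n (K * l ^ 2) l]) ->
  forall C : R, exists N : nat,
    C <= \sum_(0 <= n < N) return_prob w n.*2 0 * return_prob (fun=> 2^-1) n.*2 0.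
Proof.
move=> w01 deep; set xi := fun y => _ in deep.
pose E y := expR (potential xi y).
have rho0 y : 0 < rho w y.
  by have /andP[? ?] := w01 y; rewrite divr_gt0// subr_gt0.
apply: (@sum_return_prob_unbounded _ w E) => //.
- by move=> y; exact: expR_gt0.
- move=> y; rewrite /E potentialS expRD /xi lnK ?posrE// /rho -mulrA divfK//.
  by have /andP[? _] := w01 y; rewrite gt_eqF.
- by rewrite /E potential0 expR0.
move=> C; pose C' := Num.max C 0.
have C'0 : 0 <= C' by rewrite le_max lexx orbT.
(* Then [l] exceeds [C' * (2 K + 3)]. One factor [exp l] absorbs this constant and [exp (2 l)]
   absorbs [l^2], which leaves [exp (5 l)] against [exp (15 l / 2)]. *)
have [n [l [ml nl [j [j' [jN j'N [h1 h2] h3]]]]]] := deep (Num.truncn (C' * (2 * K%:R + 3))).+1.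
have ml' : C' * (2 * K%:R + 3) <= l%:R.
  rewrite ltW// (lt_trans (truncnS_gt _))// ltr_nat//.
(* The shifts by one make [- a.+1] and [b - 1], where the barrier is measured, the two sites of high
   potential. *)
exists (n + j').-1, (n + j).+1, (expR (15 * l%:R)), (expR (2 * l%:R)).
have e1 : (n + j).+1%:Z - 1 = (n + j)%N%:Z by lia.
have e2 : - (n + j').-1.+1%:Z = - (n + j')%N%:Z by lia.
split => //.
- by rewrite e1 /E ler_expR.
- by rewrite e2 /E ler_expR.
- split; first exact: expR_gt0.
  move=> y; rewrite e2 /E => hy; rewrite -expRN ler_expR lerNl; apply: h3; lia.
have -> : Num.sqrt (expR (15 * l%:R)) = expR (15 / 2 * l%:R) :> R.
  rewrite (_ : 15 * l%:R = (15 / 2 * l%:R) *+ 2); last by rewrite mulr2n; lra.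
  by rewrite mulr2n expRD -expr2 sqrtr_sqr ger0_norm// expR_ge0.
have l1 : 1 <= l%:R :> R by rewrite ler1n; lia.
have lexp : l%:R <= expR l%:R :> R.
  by have := @expR_ge1Dx R l%:R; lra.
have cnt : ((n + j').-1 + (n + j).+1)%:R <= (2 * K%:R + 3) * l%:R ^+ 2 :> R.
  rewrite (_ : _ * _ ^+ 2 = ((2 * K + 3) * l ^ 2)%:R); last by rewrite natrM natrX natrD natrM.
  by rewrite ler_nat; nia.
apply: (@le_trans _ _ (C' * ((n + j').-1 + (n + j).+1)%:R * expR (2 * l%:R))).
  by rewrite ler_wpM2r ?expR_ge0// ler_wpM2r// le_max lexx.
apply: (@le_trans _ _ (expR l%:R * expR l%:R ^+ 2 * expR (2 * l%:R))).
  rewrite ler_wpM2r ?expR_ge0//.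
  apply: (@le_trans _ _ (C' * (2 * K%:R + 3) * l%:R ^+ 2)).
    by rewrite -mulrA ler_wpM2l.
  apply: ler_pM => //; [by rewrite mulr_ge0//; have := ler0n R K; lra | by rewrite (le_trans ml')|].
  by rewrite lerXn2r// nnegrE ?expR_ge0.
rewrite expr2 -!expRD ler_expR; lra.
Qed.

End potential.

(** * Independent blocks of the environment *)

Section environment.
Context d (T : measurableType d) (R : realType) (P : probability T R).
Variables (omega : int -> T -> R) (g : R -> R) (C : R) (c0 K : nat).
Hypothesis gC : forall x, `|g x| <= C.
Hypothesis Cc0 : C <= c0%:R.

Lemma C_ge0 : 0 <= C. Proof. exact: le_trans (normr_ge0 _) (gC 0). Qed.

(* The scale of a block dominates [C * block_start q], a bound on the potential
   accumulated over the previous blocks. *)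
Fixpoint block_start (q : nat) : nat :=
  if q is q'.+1 then
    (block_start q' + K * (c0 * block_start q' + c0 + q'.+1) ^ 2)%N
  else 0%N.

(** The second summand makes the scale at least the step bound [C], so that an overshoot costs at
    most one scale; the third sends the scales to infinity. *)
Definition block_scale q := (c0 * block_start q + c0 + q.+1)%N.
Definition block_length q := (K * block_scale q ^ 2)%N.

Lemma block_startS q : block_start q.+1 = (block_start q + block_length q)%N.
Proof. by []. Qed.

Definition right_site q (i : nat) : int := (block_start q + i).+1%:Z.
Definition left_site q (i : nat) : int := - (block_start q + i)%N%:Z.

(** The factor [1], as [-1] on the left, fits the form [e * g x] of [block_exit_prob_ge]; walking
    left, the potential changes by the opposite of [g]. *)
Definition right_exit q := exits_above omega (right_site q) (fun x => 1 * g x)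
  (block_scale q)%:R (16 * (block_scale q)%:R) (block_length q).
Definition left_exit q := exits_above omega (left_site q) (fun x => -1 * g x)
  (block_scale q)%:R (16 * (block_scale q)%:R) (block_length q).
Definition good_block q := right_exit q `&` left_exit q.

(** On the earlier sites the potential is at most one scale [l] in absolute value. Inside the block
    it starts from at least [- l], loses less than [l] before the exit, and has gained [16 l] at the
    exit. *)
Lemma good_block_valley q t : good_block q t ->
  valley (fun y => g (omega y t)) (block_start q) (K * block_scale q ^ 2) (block_scale q).
Proof.
move=> [[j [jN hj lj]] [j' [j'N hj' lj']]]; exists j, j'.
set l := block_scale q in hj lj hj' lj' *; set n := block_start q.
set xi := fun y => g (omega y t).
have xiC y : `|xi y| <= C by exact: gC.
have C0 := C_ge0.
have nC i : (i <= n)%N -> C * i%:R <= l%:R.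
  move=> ile; apply: (@le_trans _ _ (c0%:R * n%:R)).
    by apply: ler_pM => //; rewrite ler_nat.
  by rewrite -natrM ler_nat /l /block_scale; lia.
have pr i : potential xi (n + i)%N%:Z =
    potential xi n%:Z + walk omega (right_site q) (fun x => 1 * g x) i t.
  by rewrite potential_right /walk /step; congr (_ + _); apply: eq_bigr => ? _; rewrite mul1r.
have pl i : potential xi (- (n + i)%N%:Z) =
    potential xi (- n%:Z) + walk omega (left_site q) (fun x => -1 * g x) i t.
  by rewrite potential_left /walk /step; congr (_ + _); apply: eq_bigr => ? _; rewrite mulN1r.
have small i : (i <= n)%N -> - l%:R <= potential xi i%:Z /\ - l%:R <= potential xi (- i%:Z).
  move=> ile; have [b1 b2] := potential_norm i xiC; have := nC i ile.
  by move: b1 b2; rewrite !ler_norml => /andP[b1 _] /andP[b2 _]; split; lra.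
have [s1 s2] := small n (leqnn n).
have l0 : 0 < l%:R :> R by rewrite ltr0n /l /block_scale; lia.
split => //.
(* The exit time is positive because the block walk starts at [0], below [16 l]. *)
- rewrite j'N andbT lt0n; apply/eqP => j0; move: hj'; rewrite j0 /walk big_ord0; lra.
- by rewrite pr pl; split; lra.
have right i : (i <= n + j)%N -> - (2 * l%:R) <= potential xi i%:Z.
  move=> ij; have [ile|nlt] := leqP i n; first by have [] := small i ile; lra.
  have [e|ne] := eqVneq i (n + j)%N; first by rewrite e pr; lra.
  have lt : (i - n < j)%N by lia.
  by have := lj _ lt; have := pr (i - n)%N; rewrite subnKC ?(ltnW nlt)// => ->; lra.
have left i : (i <= n + j')%N -> - (2 * l%:R) <= potential xi (- i%:Z).
  move=> ij; have [ile|nlt] := leqP i n; first by have [] := small i ile; lra.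
  have [e|ne] := eqVneq i (n + j')%N; first by rewrite e pl; lra.
  have lt : (i - n < j')%N by lia.
  by have := lj' _ lt; have := pl (i - n)%N; rewrite subnKC ?(ltnW nlt)// => ->; lra.
move=> y hy; have [y0|y0] := leP 0 y.
  by rewrite (_ : y = `|y|%N%:Z); [apply: right; lia | lia].
by rewrite (_ : y = - `|y|%N%:Z); [apply: left; lia | lia].
Qed.

Variable v : R.
Hypothesis momega : forall y, measurable_fun setT (omega y).
Hypothesis iid_omega : iid P omega.
Hypothesis mg : measurable_fun setT g.
Hypothesis g0 : mean P (g \o omega 0) = 0.
Hypothesis gv : mean P (fun t => g (omega 0 t) ^+ 2) = v.
Hypothesis Kv : 17 ^+ 2 * 34 <= K%:R * v.

Lemma v_ge0 : 0 <= v.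
Proof. by rewrite -gv Rintegral_ge0// => t _; exact: sqr_ge0. Qed.

(** As [C <= l], [inside_prob_le] and [Kv] bound the probability of not having exited by [1/34].
    Gambler's ruin then reads [l <= 18 l p + 17 l / 34], so [p] is at least [1/36]. *)
Lemma block_exit_prob_ge (k : nat -> int) (e : R) (l : nat) : injective k ->
  e ^+ 2 = 1 -> (0 < l)%N -> C <= l%:R ->
  36^-1 <= fine (P (exits_above omega k (fun x => e * g x) l%:R (16 * l%:R) (K * l ^ 2))).
Proof.
move=> kinj e1 l0 Cl; have C0 := C_ge0.
have l0R : 0 < l%:R :> R by rewrite ltr0n.
have lH : l%:R <= 16 * l%:R :> R by lra.
have [ind idd] := iid_omega.
have mphi : measurable_fun setT (fun x => e * g x).
  by apply: measurable_funM => //; exact: measurable_cst.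
have ne : `|e| = 1.
  have : `|e| ^+ 2 = 1 by rewrite real_normK ?num_real.
  by move/eqP; rewrite sqrf_eq1 => /orP[/eqP//|/eqP h]; have := normr_ge0 e; lra.
have phiC x : `|e * g x| <= C by rewrite normrM ne mul1r.
have bg : bounded_mfun g by split => //; exists C.
have bphi : bounded_mfun (fun x => e * g x) by split => //; exists C.
have bphi2 : bounded_mfun (fun x => g x ^+ 2).
  by under eq_fun do rewrite expr2; exact: bounded_mfunM.
have mean0 i : mean P (step omega k (fun x => e * g x) i) = 0.
  rewrite /step (_ : (fun t => _) = (fun x => e * g x) \o omega (k i))//.
  rewrite (mean_identically_distributed _ 0)// /comp meanZ ?[mean _ _]g0 ?mulr0//.
  by split; [exact: measurableT_comp | exists C => t; exact: gC].
have var i : mean P (fun t => step omega k (fun x => e * g x) i t ^+ 2) = v.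
  rewrite /step (_ : (fun t => _) = (fun x => g x ^+ 2) \o omega (k i)).
    by rewrite (mean_identically_distributed _ 0).
  by apply/funext => t; rewrite /= exprMn e1 mul1r.
set N := (K * l ^ 2)%N.
have := inside_prob_le momega ind kinj mphi phiC l0R lH C0 mean0 var v_ge0 N.
have := exits_above_prob_ge momega ind kinj mphi phiC l0R lH C0 mean0 N.
set pe := fine _; set pi := fine _ => h1 h2.
have pi0 : 0 <= pi by rewrite fine_ge0.
have pe0 : 0 <= pe by rewrite fine_ge0.
have h3 : pi <= 34^-1.
  have q1 : l%:R ^+ 2 * (17 ^+ 2 * 34) * pi <= N%:R * v * pi.
    rewrite ler_wpM2r// [leRHS](_ : _ = l%:R ^+ 2 * (K%:R * v)); last by rewrite natrM natrX; ring.
    by rewrite ler_wpM2l ?sqr_ge0.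
  have q2 : (16 * l%:R + C) ^+ 2 <= 17 ^+ 2 * l%:R ^+ 2.
    by rewrite -exprMn lerXn2r// ?nnegrE; lra.
  have l20 : 0 < l%:R ^+ 2 :> R by rewrite exprn_gt0.
  rewrite -(ler_pM2l l20); lra.
have h4 : (16 * l%:R + C + l%:R) * pe <= l%:R * (18 * pe).
  by rewrite [leRHS]mulrA ler_wpM2r//; lra.
have h5 : (16 * l%:R + l%:R) * pi <= l%:R * (17 * 34^-1).
  rewrite (_ : 16 * l%:R + l%:R = l%:R * 17); last by ring.
  by rewrite -mulrA ler_wpM2l//; lra.
have h6 : l%:R * 1 <= l%:R * (18 * pe + 17 * 34^-1) :> R by lra.
by rewrite ler_pM2l// in h6; lra.
Qed.

Local Notation Sg J := (<<s coordinate_events omega J >>).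

Definition right_sites q : set int := sites (right_site q) (block_length q).
Definition left_sites q : set int := sites (left_site q) (block_length q).
(** The sites read by the blocks before [q]. The asymmetry is that of the potential, whose left
    branch begins with site [0]. *)
Definition below q : set int := [set y | - (block_start q)%:Z < y <= (block_start q)%:Z].

Lemma right_exit_sigma q : Sg (right_sites q) (right_exit q).
Proof. by apply: exits_above_adapted; apply: measurable_funM => //; exact: measurable_cst. Qed.

Lemma left_exit_sigma q : Sg (left_sites q) (left_exit q).
Proof. by apply: exits_above_adapted; apply: measurable_funM => //; exact: measurable_cst. Qed.

Lemma sigma_mono (J J' : set int) A : J `<=` J' -> Sg J A -> Sg J' A.
Proof.
move=> JJ'; apply: sub_sigma_algebra2 => _ [i [B [Ji mB ->]]].
by exists i, B; split => //; exact: JJ'.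
Qed.

Lemma good_block_sigma q : Sg (right_sites q `|` left_sites q) (good_block q).
Proof.
apply: (@measurableI _ (g_sigma_algebraType (coordinate_events omega _))).
  by apply: (sigma_mono _ (@right_exit_sigma q)) => y; left.
by apply: (sigma_mono _ (@left_exit_sigma q)) => y; right.
Qed.

Lemma sigma_measurable J A : Sg J A -> measurable A.
Proof. exact: (g_sigma_algebra_sub_measurable (coordinate_events_measurable momega (J := J))). Qed.

Lemma good_block_prob q : ((36^-1 ^+ 2)%:E <= P (good_block q))%E.
Proof.
have sl : (0 < block_scale q)%N by rewrite /block_scale; lia.
have Cs : C <= (block_scale q)%:R by rewrite (le_trans Cc0)// ler_nat /block_scale; lia.
rewrite (coordinate_events_indep momega iid_omega.1 _ (@right_exit_sigma q) (@left_exit_sigma q)).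
  have m1 := sigma_measurable (@right_exit_sigma q).
  have m2 := sigma_measurable (@left_exit_sigma q).
  rewrite -[P (right_exit q)]fineK ?fin_num_measure// -[P (left_exit q)]fineK ?fin_num_measure//.
  rewrite -EFinM lee_fin expr2; apply: ler_pM => //.
    by apply: block_exit_prob_ge => //; [move=> i j; rewrite /right_site; lia | rewrite expr1n].
  by apply: block_exit_prob_ge => //; [move=> i j; rewrite /left_site; lia | rewrite sqrrN expr1n].
apply/disj_setPS => y [[i _ <-] [j _]]; rewrite /left_site /right_site; lia.
Qed.

Definition no_good m r := \bigcap_(q in [set q | (m <= q < m + r)%N]) ~` good_block q.

Lemma no_goodS m r : no_good m r.+1 = no_good m r `&` ~` good_block (m + r)%N.
Proof.
apply/seteqP; split => t.
  by move=> H; split; [move=> q /= hq; apply: H => /=; lia | apply: H => /=; lia].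
move=> [H1 H2] q /= hq; have [->//|ne] := eqVneq q (m + r)%N.
by apply: H1 => /=; lia.
Qed.

Lemma no_good_sigma m r : Sg (below (m + r)%N) (no_good m r).
Proof.
elim: r => [|r IH].
  rewrite (_ : no_good m 0 = setT).
    exact: (@measurableT _ (g_sigma_algebraType (coordinate_events omega _))).
  by apply/seteqP; split => t // _ q /=; lia.
rewrite no_goodS addnS.
apply: (@measurableI _ (g_sigma_algebraType (coordinate_events omega _))).
  by apply: (sigma_mono _ IH) => y; rewrite /below block_startS/=; lia.
apply: (@measurableC _ (g_sigma_algebraType (coordinate_events omega _))).
apply: (sigma_mono _ (@good_block_sigma (m + r))) => y.
by rewrite /below block_startS/= => -[[i /= il <-]|[i /= il <-]]; rewrite /left_site /right_site; lia.
Qed.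

(** Each new block reads fresh sites, so it fails independently of the earlier ones; it succeeds
    when its two independent sides do. *)
Lemma no_good_prob m r : (P (no_good m r) <= ((1 - 36^-1 ^+ 2) ^+ r)%:E)%E.
Proof.
elim: r => [|r IH]; first by rewrite expr0 probability_le1//; exact: sigma_measurable (@no_good_sigma _ _).
have sC : Sg (right_sites (m + r) `|` left_sites (m + r)) (~` good_block (m + r)).
  apply: (@measurableC _ (g_sigma_algebraType (coordinate_events omega _))).
  exact: (@good_block_sigma (m + r)).
rewrite no_goodS (coordinate_events_indep momega iid_omega.1 _ (@no_good_sigma m r) sC); last first.
  apply/disj_setPS => y [by_ [[i _ e]|[i _ e]]]; move: by_; rewrite /below /= -e /left_site /right_site; lia.
rewrite exprSr EFinM; apply: lee_pmul => //.
rewrite probability_setC; last exact: sigma_measurable (@good_block_sigma _).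
by rewrite EFinB leeB// good_block_prob.
Qed.

Lemma good_blocks_infinitely_often :
  {ae P, forall t, forall m, exists2 q, (m <= q)%N & good_block q t}.
Proof.
pose B m := \bigcap_r no_good m r.
have mB m : measurable (B m).
  by apply: bigcap_measurable => // r _; exact: sigma_measurable (@no_good_sigma _ _).
have PB m : P (B m) = 0%E.
  apply/eqP; rewrite -measure_le0; apply/lee_addgt0Pr => e e0; rewrite add0e.
  have x0 : 0 <= 1 - 36^-1 ^+ 2 :> R by rewrite expr2; lra.
  have x1 : `|1 - 36^-1 ^+ 2 : R| < 1 by rewrite ger0_norm// expr2; lra.
  have := cvg_expr x1 => /cvgr0Pnorm_lt/(_ _ e0)[r _ /(_ r (leqnn r))] /= hr.
  rewrite (@le_trans _ _ (P (no_good m r)))//.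
    by apply: le_measure; rewrite ?inE//; [exact: sigma_measurable (@no_good_sigma _ _) | move=> t; apply].
  rewrite (le_trans (no_good_prob m r))// lee_fin ltW// (le_lt_trans _ hr)//.
  by rewrite ger0_norm// exprn_ge0.
have neg : P.-negligible (\bigcup_m B m).
  by apply: negligible_bigcup => m; exists (B m); split; [exact: mB | exact: PB | by []].
apply: negligibleS neg => t /= /existsNP[m Hm]; exists m => // r _ q /= /andP[mq _] gq.
by apply: Hm; exists q.
Qed.

End environment.

(** * The walks *)

Section walks.
Context d (T : measurableType d) (R : realType) (Q : probability T R).

Definition prob (A : set T) : R := fine (Q A).

Lemma probK A : measurable A -> Q A = (prob A)%:E.
Proof. by move=> mA; rewrite /prob fineK// fin_num_measure. Qed.

Lemma prob_ge0 A : 0 <= prob A. Proof. by rewrite fine_ge0. Qed.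

Lemma prob_le A B : measurable A -> measurable B -> A `<=` B -> prob A <= prob B.
Proof. by move=> mA mB AB; rewrite -lee_fin -!probK//; apply: le_measure; rewrite ?inE. Qed.

Lemma prob_disjointU A B : measurable A -> measurable B -> A `&` B = set0 ->
  prob (A `|` B) = prob A + prob B.
Proof.
move=> mA mB AB; apply: EFin_inj; rewrite EFinD -!probK//; last exact: measurableU.
by rewrite measureU.
Qed.

Lemma measurable_preimage_int (X : {RV Q >-> int}) (A : set int) : measurable (X @^-1` A).
Proof. by rewrite -[X in measurable X]setTI; exact: measurable_funPT. Qed.

Lemma measurable_eq_int (X : {RV Q >-> int}) (y : int) : measurable [set t | X t = y].
Proof. exact: (measurable_preimage_int X [set y]). Qed.

Lemma measurable_cylinder (X : nat -> {RV Q >-> int}) n x :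
  measurable (cylinder (fun n => X n : T -> int) n x).
Proof.
apply: measurable_forall_nat => i; apply: measurable_impl.
exact: measurable_eq_int.
Qed.

Lemma cylinderS (S : countType) (X : nat -> T -> S) n x :
  cylinder X n.+1 x = [set t | X n.+1 t = x n.+1] `&` cylinder X n x.
Proof.
apply/seteqP; split => t.
  by move=> H; split; [exact: H | move=> i /leqW; exact: H].
by move=> [H1 H2] i; rewrite leq_eqVlt => /orP[/eqP ->//|]; exact: H2.
Qed.

Definition walk_kernel (w : int -> R) (x z : int) : R :=
  if z == x + 1 then w x else if z == x - 1 then 1 - w x else 0.

Lemma rwe_cylinder (w : int -> R) (X : nat -> {RV Q >-> int}) n x :
  random_walk_in_environment Q w (fun n => X n) ->
  prob (cylinder (fun n => X n : T -> int) n.+1 x) =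
  prob (cylinder (fun n => X n : T -> int) n x) * walk_kernel w (x n) (x n.+1).
Proof.
move=> [_ markov trans]; rewrite cylinderS.
have mc := measurable_cylinder X n x.
have me m y : measurable [set t | X m t = y] := measurable_eq_int (X m) y.
set past := cylinder _ n x in mc *.
have [p0|p0] := eqVneq (prob past) 0.
  rewrite p0 mul0r; apply/eqP; rewrite eq_le prob_ge0 andbT -p0.
  by apply: prob_le => //; exact: measurableI.
have q0 : prob [set t | X n t = x n] != 0.
  rewrite gt_eqF//; apply: (@lt_le_trans _ _ (prob past)).
    by rewrite lt_neqAle eq_sym p0 prob_ge0.
  by apply: prob_le => // t; exact.
have Q0 A : measurable A -> prob A != 0 -> Q A != 0%E.
  by move=> mA; apply: contra => /eqP; rewrite /prob => ->.
have := markov n x (x n.+1) (Q0 _ mc p0); rewrite /cond_prob.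
rewrite -![fine _]/(prob _) -/past => /(canRL (divfK p0)) ->.
rewrite mulrC; congr (_ * _).
have [up down] := trans n (x n) (Q0 _ (me _ _) q0).
move: up down; rewrite /cond_prob -![fine _]/(prob _) /walk_kernel => up down.
case: eqP => [->//|ne1]; case: eqP => [->//|ne2].
(* The two neighbours already carry all the mass of [B], since [w y + (1 - w y) = 1]; any other
   target has probability zero. *)
set B := [set t | X n t = x n] in q0 up down *.
have mB : measurable B := me _ _.
have mI y : measurable ([set t | X n.+1 t = y] `&` B) by exact: measurableI.
have dis y y' : y <> y' -> ([set t | X n.+1 t = y] `&` B) `&` ([set t | X n.+1 t = y'] `&` B) = set0.
  by move=> yy'; apply/seteqP; split => t // [[/= e1 _] [/= e2 _]]; apply: yy'; rewrite -e1 -e2.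
have : prob ((([set t | X n.+1 t = x n + 1] `&` B) `|` ([set t | X n.+1 t = x n - 1] `&` B))
    `|` ([set t | X n.+1 t = x n.+1] `&` B)) <= prob B.
  apply: prob_le => //; first by apply: measurableU => //; exact: measurableU.
  by move=> t [[[]|[]]|[]].
rewrite prob_disjointU//; last 2 first.
- exact: measurableU.
- by rewrite setIUl !dis ?setU0//; [exact/nesym | exact/nesym].
rewrite prob_disjointU//; last by apply: dis; lia.
rewrite (canRL (divfK q0) up) (canRL (divfK q0) down) => h.
have : prob ([set t | X n.+1 t = x n.+1] `&` B) = 0.
  by apply/eqP; rewrite eq_le prob_ge0 andbT; lra.
by move=> ->; rewrite mul0r.
Qed.

(** Written with the law of the first increment, so that the product rule follows directly from the
    i.i.d. assumption. *)
Definition increment_kernel (Y : nat -> T -> int) (y z : int) : R :=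
  prob [set t | increment Y 0 t = z - y].

Lemma srw_cylinder (Y : nat -> {RV Q >-> int}) n y :
  symmetric_random_walk Q (fun n => Y n) ->
  prob (cylinder (fun n => Y n : T -> int) n.+1 y) =
  prob (cylinder (fun n => Y n : T -> int) n y) *
  increment_kernel (fun n => Y n) (y n) (y n.+1).
Proof.
set Y' := (fun n => Y n : T -> int).
move=> [Y0 [ind idd] _].
have mc m : measurable (cylinder Y' m y) := measurable_cylinder Y m y.
have m0 z : measurable [set t | Y 0%N t = z] := measurable_eq_int (Y 0%N) z.
have [y0|ny0] := eqVneq (y 0%N) 0; last first.
  suff e m : prob (cylinder Y' m y) = 0 by rewrite !e mul0r.
  apply/eqP; rewrite eq_le prob_ge0 andbT.
  apply: (@le_trans _ _ (prob (~` [set t | Y 0%N t = 0]))).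
    apply: prob_le; [exact: mc | exact: measurableC |].
    by move=> t H /= e2; move/eqP: ny0; apply; rewrite -(H 0%N isT); exact: e2.
  by rewrite /prob probability_setC// Y0 subee.
pose Inc m := \bigcap_(i in [set` iota 0 m]) (increment Y' i @^-1` [set y i.+1 - y i]).
have cE m : cylinder Y' m y = [set t | Y 0%N t = 0] `&` Inc m.
  apply/seteqP; split => t.
    move=> H; split; first by rewrite /= -y0; exact: H.
    by move=> i /=; rewrite mem_iota /= => im; rewrite /increment !H//; lia.
  move=> [H0 Hi]; elim=> [_|i IH im]; first by rewrite y0.
  have := Hi i; rewrite /= mem_iota /= => /(_ _); rewrite /increment IH; last lia.
  by move=> h; have := h _; lia.
have PI m : prob (cylinder Y' m y) = \prod_(i < m) increment_kernel Y' (y i) (y i.+1).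
  have inc_meas i z : measurable (increment Y' i @^-1` [set z]).
    rewrite (_ : _ @^-1` _ = \bigcup_a ([set t | Y i t = a] `&` [set t | Y i.+1 t = a + z])).
      by apply: countable_bigcupT_measurable => [|a]; [exact: countableP | apply: measurableI; exact: measurable_eq_int].
    apply/seteqP; split => t /=.
      by rewrite /increment => e; exists (Y i t) => //; split => //=; rewrite -e addrC subrK.
    by move=> [a _ [/= e1 e2]]; rewrite /increment /Y' e1 e2 addrAC subrr add0r.
  have mI : measurable (Inc m).
    by apply: fin_bigcap_measurable => [|i _]; [exact: finite_seq | exact: inc_meas].
  (* The constraint on [Y 0] costs nothing, because it holds almost surely. *)
  have -> : prob (cylinder Y' m y) = prob (Inc m).
    apply/eqP; rewrite eq_le prob_le//=; last by rewrite cE => t [].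
    have mD : measurable (~` [set t | Y 0%N t = 0]) by exact: measurableC.
    apply: (@le_trans _ _ (prob (cylinder Y' m y `|` (Inc m `&` ~` [set t | Y 0%N t = 0])))).
      apply: prob_le => //; first by apply: measurableU => //; exact: measurableI.
      by move=> t It; rewrite cE; have [e|e] := pselect (Y 0%N t = 0); [left|right].
    rewrite prob_disjointU//; last 2 first.
    - exact: measurableI.
    - by rewrite cE; apply/seteqP; split => t // [[? _] [_ +]].
    rewrite gerDl; apply: (@le_trans _ _ (prob (~` [set t | Y 0%N t = 0]))).
      by apply: prob_le => //; exact: measurableI.
    by rewrite /prob probability_setC// Y0 subee.
  rewrite /prob ind ?iota_uniq//.
  rewrite (_ : iota 0 m = index_iota 0 m); last by rewrite /index_iota subn0.
  rewrite big_mkord; apply: EFin_inj.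
  transitivity (\prod_(i < m) Q (increment Y' i @^-1` [set (y i.+1 - y i)%R]))%E.
    rewrite fineK//; apply: (big_ind (fun x : \bar R => x \is a fin_num)) => //.
      by move=> a b fa fb; exact: fin_numM.
    by move=> i _; rewrite fin_num_measure.
  rewrite (big_morph EFin (fun a b : R => EFinM a b) (erefl 1%E)).
  apply: eq_bigr => i _; rewrite /increment_kernel (idd i 0%N)//.
  exact: probK (inc_meas 0%N _).
by rewrite !PI big_ord_recr.
Qed.

(** Following only the nearest-neighbour paths gives a lower bound, the direction that the
    divergence of the expected number of visits requires. *)
Lemma markov_return_ge (X : nat -> {RV Q >-> int}) (K : int -> int -> R) (w : int -> R) :
  (forall y, 0 < w y < 1) ->
  (forall y, w y <= K y (y + 1)) -> (forall y, 1 - w y <= K y (y - 1)) ->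
  Q [set t | X 0%N t = 0] = 1%E ->
  (forall n x, prob (cylinder (fun n => X n : T -> int) n.+1 x) =
    prob (cylinder (fun n => X n : T -> int) n x) * K (x n) (x n.+1)) ->
  forall m, return_prob w m 0 <= prob [set t | X m t = 0].
Proof.
move=> w01 Kup Kdown X0 XK m.
pose X' := (fun n => X n : T -> int).
have mI n x k : measurable (cylinder X' n x `&` [set t | X k t = 0]).
  by apply: measurableI; [exact: measurable_cylinder | exact: measurable_eq_int].
(* Generalised to an arbitrary past, since the induction on [m] moves the starting point one step
   forward. *)
suff H n x : prob (cylinder X' n x) * return_prob w m (x n) <=
    prob (cylinder X' n x `&` [set t | X (n + m)%N t = 0]).
  have := H 0%N (fun=> 0); rewrite (_ : cylinder X' 0 _ = [set t | X 0%N t = 0]).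
    rewrite {1}/prob X0 /= mul1r add0n => /le_trans; apply; apply: prob_le => //.
    - by apply: measurableI; exact: measurable_eq_int.
    - exact: measurable_eq_int.
  by apply/seteqP; split => t; [apply | move=> /= e i; rewrite leqn0 => /eqP ->].
elim: m n x => [|m IH] n x.
  rewrite addn0 /=; case: eqP => [x0|_]; last by rewrite mulr0 prob_ge0.
  rewrite mulr1; apply: prob_le => //; first exact: measurable_cylinder.
  by move=> t H; split => //=; rewrite -x0; exact: H.
pose ext (z : int) i := if (i <= n)%N then x i else z.
have extn z : ext z n = x n by rewrite /ext leqnn.
have extS z : ext z n.+1 = z by rewrite /ext ltnn.
have cext z : cylinder X' n (ext z) = cylinder X' n x.
  by apply/seteqP; split => t H i im; rewrite H// /ext im.
have IHz z : prob (cylinder X' n x) * (K (x n) z * return_prob w m z) <=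
    prob (cylinder X' n.+1 (ext z) `&` [set t | X (n + m.+1)%N t = 0]).
  by have := IH n.+1 (ext z); rewrite XK cext extn extS -mulrA addSnnS.
set U := cylinder X' n x.
apply: (@le_trans _ _ (prob ((cylinder X' n.+1 (ext (x n + 1)) `&` [set t | X (n + m.+1)%N t = 0]) `|`
   (cylinder X' n.+1 (ext (x n - 1)) `&` [set t | X (n + m.+1)%N t = 0])))); last first.
  apply: prob_le; [exact: measurableU | exact: mI |].
  move=> t [] [H Z]; split => // i im; rewrite H ?leqW// /ext im//.
rewrite prob_disjointU//; last first.
  apply/seteqP; split => t // [[H1 _] [H2 _]].
  by have := H1 n.+1 (leqnn _); rewrite (H2 n.+1 (leqnn _)) !extS; lia.
apply: le_trans (lerD (IHz _) (IHz _)).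
rewrite -mulrDr ler_wpM2l ?prob_ge0//=.
by apply: lerD; apply: ler_wpM2r => //; exact: return_prob_ge0.
Qed.

Lemma product_walk_recurrent (w : int -> R) (X Y : nat -> {RV Q >-> int}) :
  (forall y, 0 < w y < 1) ->
  (forall C : R, exists N : nat,
    C <= \sum_(0 <= n < N) return_prob w n.*2 0 * return_prob (fun=> 2^-1) n.*2 0) ->
  random_walk_in_environment Q w (fun n => X n) ->
  symmetric_random_walk Q (fun n => Y n) ->
  independent_processes Q (fun n => X n : T -> int) (fun n => Y n) ->
  recurrent Q (fun (n : nat) (t : T) => (X n t, Y n t)).
Proof.
move=> w01 unb rwX rwY ind.
set X' := (fun n => X n : T -> int); set Y' := (fun n => Y n : T -> int).
pose K (z z' : int * int) := walk_kernel w z.1 z'.1 * increment_kernel Y' z.2 z'.2.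
have [X0 _ _] := rwX; have [Y0 _ Yinc] := rwY.
have indE (A B : set T) : process_sigma_algebra X' A -> process_sigma_algebra Y' B ->
    measurable A -> measurable B -> prob (A `&` B) = prob A * prob B.
  by move=> sA sB mA mB; rewrite /prob ind// fineM ?fin_num_measure.
have sig (V : nat -> T -> int) n x : process_sigma_algebra V (cylinder V n x).
  pose TG := g_sigma_algebraType [set A | exists i (B : set int), measurable B /\ A = V i @^-1` B].
  apply: (@measurable_forall_nat _ TG) => i; apply: (@measurable_impl _ TG).
  by apply: sub_sigma_algebra; exists i, [set x i].
have sig1 (V : nat -> T -> int) n (z : int) : process_sigma_algebra V [set t | V n t = z].
  by apply: sub_sigma_algebra; exists n, [set z].
pose Z n t := (X n t, Y n t).
have cZ n z : cylinder Z n z = cylinder X' n (fun i => (z i).1) `&` cylinder Y' n (fun i => (z i).2).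
  apply/seteqP; split => t.
    by move=> H; split => i im /=; have := H i im; rewrite /Z => <-.
  move=> [H1 H2] i im; rewrite /Z [LHS]surjective_pairing /=.
  by rewrite [X i t](H1 i im) [Y i t](H2 i im) -surjective_pairing.
have PcZ n z : prob (cylinder Z n z) =
    prob (cylinder X' n (fun i => (z i).1)) * prob (cylinder Y' n (fun i => (z i).2)).
  by rewrite cZ indE//; exact: measurable_cylinder.
have mcZ n z : measurable (cylinder Z n z).
  by rewrite cZ; apply: measurableI; exact: measurable_cylinder.
have PZ n : prob [set t | Z n t = (0, 0)] = prob [set t | X n t = 0] * prob [set t | Y n t = 0].
  rewrite -indE//; try exact: measurable_eq_int; try exact: (sig1 X'); try exact: (sig1 Y').
  by congr prob; apply/seteqP; split => t /=; [move=> [-> ->] | rewrite /Z => -[-> ->]].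
have mZ n (A : set (int * int)) : measurable (Z n @^-1` A).
  rewrite (_ : _ @^-1` _ = \bigcup_p [set t | A p /\ (X n t = p.1 /\ Y n t = p.2)]).
    apply: countable_bigcupT_measurable => // p.
    have [Ap|nAp] := pselect (A p).
      rewrite (_ : [set t | _] = [set t | X n t = p.1] `&` [set t | Y n t = p.2]).
        by apply: measurableI; exact: measurable_eq_int.
      by apply/seteqP; split => t /=; tauto.
    by rewrite (_ : [set t | _] = set0)//; apply/seteqP; split => t // [].
  apply/seteqP; split => t /=; first by move=> AZ; exists (Z n t).
  by move=> [[a b] _ [Ap [/= e1 e2]]]; rewrite /Z e1 e2.
apply: (@markov_recurrent _ T R Q (int * int)%type Z (0, 0) K).
- move=> s s'; apply: mulr_ge0; last exact: prob_ge0.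
  rewrite /walk_kernel; have /andP[? ?] := w01 s.1.
  by case: ifP => _; [exact: ltW | case: ifP => _ //; rewrite subr_ge0 ltW].
- exact: mZ.
- rewrite probK; last exact: (mZ 0%N [set (0, 0)]).
  by rewrite PZ /prob X0 Y0 /= mulr1.
- move=> n z; rewrite !probK// -EFinM; congr EFin.
  by rewrite !PcZ (rwe_cylinder _ _ rwX) (srw_cylinder _ _ rwY) /K; ring.
(* The even times below [2 N] already suffice; the odd ones contribute nonnegative terms. *)
move=> C; have [N hN] := unb C; exists N.*2.
have e n : Q [set t | Z n t = (0, 0)] = (prob [set t | X n t = 0] * prob [set t | Y n t = 0])%:E.
  by rewrite probK ?PZ//; exact: (mZ n [set (0, 0)]).
under eq_bigr do rewrite e.
rewrite sumEFin lee_fin; apply: (le_trans hN).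
have retX m := markov_return_ge (K := walk_kernel w) w01 _ _ X0 (fun n x => rwe_cylinder n x rwX) m.
have w12 : forall y : int, 0 < (2^-1 : R) < 1 by move=> _; apply/andP; split; lra.
have retY m := markov_return_ge (K := increment_kernel Y') w12 _ _ Y0 (fun n x => srw_cylinder n x rwY) m.
have {}retX m : return_prob w m 0 <= prob [set t | X m t = 0].
  apply: retX => y; rewrite /walk_kernel ?eqxx//.
  by case: eqP => //; lia.
have {}retY m : return_prob (fun=> 2^-1) m 0 <= prob [set t | Y m t = 0].
  apply: retY => y; rewrite /increment_kernel /prob.
    by rewrite [y + 1]addrC addrK (Yinc 0%N).1.
  by rewrite addrAC subrr add0r (Yinc 0%N).2 /= {w12}; lra.
elim: N {hN} => [|N IH]; first by rewrite !big_geq.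
rewrite doubleS !big_nat_recr//= -addrA lerD//.
apply: (@le_trans _ _ (prob [set t | X N.*2 t = 0] * prob [set t | Y N.*2 t = 0])).
  by apply: ler_pM => //; exact: return_prob_ge0.
by rewrite lerDl mulr_ge0// prob_ge0.
Qed.

End walks.

(** * A bounded version of the log ratio *)

Section truncated_log_ratio.
Context {R : realType}.
Variable eps : R.
Hypothesis eps0 : 0 < eps.

(** Ellipticity holds only almost surely; the cut-off gives a function bounded everywhere, equal to
    the log ratio on the elliptic range. *)
Definition truncated_log_ratio (x : R) : R :=
  (ln (1 - x) - ln x) * \1_[set` `[eps, 1 - eps]] x.

Lemma measurable_truncated_log_ratio : measurable_fun setT truncated_log_ratio.
Proof.
apply: measurable_funM; last exact: measurable_indic.
apply: measurable_funB; last exact: measurable_ln.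
by apply: measurableT_comp; [exact: measurable_ln | exact: measurable_funB].
Qed.

Lemma truncated_log_ratioE x : eps <= x <= 1 - eps ->
  truncated_log_ratio x = ln ((1 - x) / x).
Proof.
move=> /andP[h1 h2]; rewrite /truncated_log_ratio indicE mem_set ?mulr1; last first.
  by rewrite /= in_itv /= h1 h2.
by rewrite ln_div ?posrE//; move: eps0; lra.
Qed.

Lemma truncated_log_ratio_bound x : `|truncated_log_ratio x| <= `|ln eps|.
Proof.
rewrite /truncated_log_ratio indicE; have [|] := boolP (x \in _); last by rewrite mulr0 normr0.
rewrite inE /= in_itv /= => /andP[h1 h2]; rewrite mulr1.
have a1 : ln eps <= ln x by rewrite ler_ln ?posrE//; move: eps0; lra.
have a2 : ln eps <= ln (1 - x) by rewrite ler_ln ?posrE//; move: eps0; lra.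
have b1 : ln x <= 0 by rewrite ln_le0//; move: eps0; lra.
have b2 : ln (1 - x) <= 0 by rewrite ln_le0//; move: eps0; lra.
by rewrite (ler0_norm (le_trans a1 b1)) ler_norml; apply/andP; split; move: eps0; lra.
Qed.

End truncated_log_ratio.

Theorem corollary6p6 (R : realType) (d : measure_display)
    (Omega : measurableType d) (P : probability Omega R)
    (omega : int -> {RV P >-> R})
    (omega_in01 : forall (x : int) (o : Omega), 0 < omega x o < 1)
    (omega_iid : iid P (fun x : int => omega x : Omega -> R))
    (mean_log_rho0 :
      ('E_P[fun o : Omega => ln (rho (fun x : int => omega x o) 0)] = 0)%E)
    (elliptic : exists eps : R, 0 < eps < 2^-1 /\
      P [set o : Omega | eps <= omega 0 o <= 1 - eps] = 1%E)
    (var_log_rho0 :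
      (0 < 'V_P[fun o : Omega => ln (rho (fun x : int => omega x o) 0)])%E) :
  {ae P, forall o : Omega,
    forall (d' : measure_display) (T : measurableType d')
      (Q : probability T R) (X Y : nat -> {RV Q >-> int}),
      random_walk_in_environment Q (fun x : int => omega x o)
        (fun n : nat => X n) ->
      symmetric_random_walk Q (fun n : nat => Y n) ->
      independent_processes Q (fun n : nat => X n : T -> int)
        (fun n : nat => Y n) ->
      recurrent Q (fun (n : nat) (t : T) => (X n t, Y n t))}.
Proof.
have [eps [/andP[eps0 eps2] Peps]] := elliptic.
pose g := truncated_log_ratio eps.
pose om (y : int) := omega y : Omega -> R.
have mom y : measurable_fun setT (om y) by exact: measurable_funPT.
have mg : measurable_fun setT g by exact: measurable_truncated_log_ratio.
have gC x : `|g x| <= `|ln eps| by exact: truncated_log_ratio_bound.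
pose I : set R := [set` `[eps, 1 - eps]].
have mI : measurable I by exact: measurable_itv.
have mpre y (A : set R) : measurable A -> measurable (om y @^-1` A).
  by move=> mA; rewrite -[X in measurable X]setTI; exact: mom.
have ell y : P.-negligible (om y @^-1` (~` I)).
  exists (om y @^-1` (~` I)); split => //; first exact/mpre/measurableC.
  rewrite (omega_iid.2 y 0); last exact: measurableC.
  have -> : om 0 @^-1` (~` I) = ~` [set o | eps <= omega 0 o <= 1 - eps].
    by apply/seteqP; split => o; rewrite /I /= in_itv.
  rewrite probability_setC ?Peps ?subee//.
  rewrite (_ : [set o | _] = om 0 @^-1` I); first exact: (mpre 0 I mI).
  by apply/seteqP; split => o; rewrite /I /= in_itv.
have gE y o : I (om y o) -> g (om y o) = ln (rho (fun x => om x o) y).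
  by rewrite /I /= in_itv /= => h; rewrite /g truncated_log_ratioE.
have mlr : measurable_fun setT (fun o => ln (rho (fun x => om x o) 0)).
  rewrite (_ : (fun o => _) = fun o => ln (1 - om 0 o) - ln (om 0 o)).
    apply: measurable_funB; last by apply: measurableT_comp => //; exact: measurable_ln.
    by apply: measurableT_comp; [exact: measurable_ln | exact: measurable_funB].
  by apply/funext => o; have /andP[? ?] := omega_in01 0 o; rewrite /rho ln_div// posrE// subr_gt0.
set f := fun o => ln _ in mlr.
have fg (h : R -> R) : measurable_fun setT h ->
    (\int[P]_o (h (f o))%:E = \int[P]_o (h (g (om 0 o)))%:E)%E.
  move=> mh; apply: ae_eq_integral => //.
  - by apply/measurable_EFinP; exact: measurableT_comp.
  - by apply/measurable_EFinP; apply: measurableT_comp => //; exact: measurableT_comp.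
  apply: negligibleS (ell 0) => o /= ne Io; apply: ne => _.
  by rewrite gE.
have Ef0 : (\int[P]_o (f o)%:E = 0)%E by rewrite -mean_log_rho0 unlock.
have g0 : mean P (g \o om 0) = 0.
  by rewrite /mean /Rintegral -[X in fine X](fg id)// Ef0.
have bg2 : bounded_mfun (fun o => g (om 0 o) ^+ 2).
  under eq_fun do rewrite expr2; apply: bounded_mfunM;
    (split; [exact: measurableT_comp | by exists `|ln eps| => o; exact: gC]).
(* As the mean of the log ratio is zero, its second moment is its variance. *)
have v0 : 0 < mean P (fun o => g (om 0 o) ^+ 2).
  rewrite /mean /Rintegral fine_gt0//; apply/andP; split; last first.
    have := integrable_fin_num measurableT (bounded_mfun_integrable P bg2).
    by rewrite ge0_fin_numE// integral_ge0// => o _; rewrite lee_fin sqr_ge0.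
  rewrite -(fg (fun x => x ^+ 2)); last exact: measurable_funX.
  move: var_log_rho0; rewrite /variance unlock mean_log_rho0 /= unlock.
  congr (0 < _)%E; apply: eq_integral => o _; congr EFin.
  have e : (f o - 0) * (f o - 0) = f o ^+ 2 by rewrite subr0 expr2.
  exact: e.
set v := mean P _ in v0.
pose C := `|ln eps|.
(* The successor gives [C <= c0] and also [0 < c0], from which [block_start <= block_scale]. *)
pose c0 := (Num.truncn C).+1.
pose K := (Num.truncn ((17 ^+ 2 * 34) / v)).+1.
have Cc0 : C <= c0%:R by rewrite ltW// truncnS_gt.
have Kv : 17 ^+ 2 * 34 <= K%:R * v.
  by rewrite -ler_pdivrMr// ltW// truncnS_gt.
have io := good_blocks_infinitely_often gC Cc0 mom omega_iid mg g0 erefl Kv.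
(* A countable union over all sites, enumerated by [unpickle]; numbers that code no integer repeat
   site [0]. *)
have ellN : P.-negligible (\bigcup_n (om (if unpickle n is Some y then y else 0) @^-1` (~` I))).
  by apply: negligible_bigcup => n; exact: ell.
apply: negligibleS (negligibleU io ellN) => o /= bad.
have [good|ngood] := pselect (forall m, exists2 q, (m <= q)%N & good_block om g c0 K q o); last by left.
(* The environment is fixed from here on, outside a null set chosen without reference to the
   walks. *)
right; apply: contrapT => nell; apply: bad => d' T Q X Y.
have allI y : I (om y o).
  apply: contrapT => nI; apply: nell; exists (pickle y) => //.
  by rewrite pickleK.
apply: product_walk_recurrent => //.
apply: (@valley_sum_return_prob_unbounded _ _ K) => // m.
have [q mq gq] := good m.
exists (block_start c0 K q), (block_scale c0 K q); split.
- by rewrite /block_scale; lia.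
- by rewrite /block_scale /c0; nia.
have := good_block_valley gC Cc0 gq.
by congr (valley _ _ _ _); apply/funext => y; rewrite gE.
Qed.
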